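(* Let $p$ be a prime and let $G$ be a finite $2$-generator $p$-group of nilpotency class two. (a) If $p$ is odd, then $G$ is $2$-capable if and only if $G$ is isomorphic to exactly one of the following groups: (i) $G_1=\langle a,b \mid [a,b]^{p^{\alpha}}=a^{p^{\alpha}}=b^{p^{\alpha}}=[a,b,b]=[a,b,a]=1\rangle$, where $\alpha\ge 1$; (ii) $G_2=\langle a,b \mid [a,b]^{p^{\gamma}}=a^{p^{\alpha}}=b^{p^{\alpha}}=[a,b,b]=[a,b,a]=1\rangle$, where $\alpha>\gamma\ge 1$; (iii) $G_3=\langle a,b \mid [a,b]^{p^{\gamma}}=a^{p^{\alpha}}=[a,b,b]=[a,b,a]=1,\ b^{p^{\beta}}=[a,b]^{p^{\sigma}}\rangle$, where $\alpha\ge\beta\ge\gamma\ge 1$, $\alpha-\beta=\gamma-\sigma$ and $0\le\sigma<\gamma$. (b) If $p=2$, then $G$ is $2$-capable if and only if $G$ is isomorphic to exactly one of the following groups: (iv) $G_4=\langle a,b \mid [a,b]^{2^{\beta}}=a^{2^{\beta}}=b^{2^{\beta}}=[a,b,b]=[a,b,a]=1\rangle$, where $\beta\ge 1$; (v) $G_5=\langle a,b \mid [a,b]^{2^{\beta}}=a^{2^{\beta+1}}=b^{2^{\beta}}=[a,b,b]=[a,b,a]=1\rangle$, where $\beta\ge 1$; (vi) $G_6=\langle a,b \mid [a,b]^{2^{\gamma}}=a^{2^{\alpha}}=b^{2^{\alpha}}=[a,b,b]=[a,b,a]=1\rangle$, where $\alpha>\gamma\ge 1$; (vii) $G_7=\langle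 a,b \mid [a,b]^{2^{\gamma}}=a^{2^{\alpha}}=[a,b,b]=[a,b,a]=1,\ b^{2^{\beta}}=[a,b]^{2^{\sigma}}\rangle$, where $\beta\ge\gamma\ge1$, $\sigma\ge 0$, $\alpha-\beta>\delta_{\beta\gamma}$, $\alpha-\beta=\gamma-\sigma$, $\alpha>\beta$ and $\gamma>\sigma$.
   Context: Commutators are left-normed: $[x,y,z]=[[x,y],z]$. A group $G$ is $c$-capable ($c\ge1$) if $G\cong H/Z_c(H)$ for some group $H$, where $Z_c(H)$ is the $c$-th term of the upper central series of $H$. $\delta_{ij}$ is the Kronecker delta. Class two means nilpotency class exactly two. *)

(* Defs.v *)
From HB Require Import structures.
From mathcomp Require Import all_boot all_fingroup all_solvable.
From mathcomp Require Import generic_quotient boolp.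

Set Implicit Arguments.
Unset Strict Implicit.
Unset Printing Implicit Defensive.

Local Open Scope group_scope.
Local Open Scope quotient_scope.

(* A [groupType] is an arbitrary, possibly infinite, group.  Its underlying    *)
(* choiceType structure is no restriction classically (gen_eqMixin and         *)
(* gen_choiceMixin in boolp).  The predicates below are Prop-valued because    *)
(* membership in a term of the upper central series need not be decidable.     *)

Record normalSubgroup (H : groupType) := NormalSubgroup {
  nsub_mem :> H -> Prop;
  nsub1 : nsub_mem 1;
  nsubM : forall x y, nsub_mem x -> nsub_mem y -> nsub_mem (x * y);
  nsubV : forall x, nsub_mem x -> nsub_mem x^-1;
  nsubJ : forall x y, nsub_mem x -> nsub_mem (x ^ y) }.

Section QuotientGroup.

Variables (H : groupType) (N : normalSubgroup H).

Definition coset_rel : rel H := fun x y => `[< N (x^-1 * y) >].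

Lemma coset_rel_refl : reflexive coset_rel.
Proof. by move=> x; apply/asboolP; rewrite mulVg; apply: nsub1. Qed.

Lemma coset_rel_imply x y : coset_rel x y -> coset_rel y x.
Proof.
move=> /asboolP Nxy; apply/asboolP.
by have := nsubV Nxy; rewrite invgM invgK.
Qed.

Lemma coset_rel_sym : symmetric coset_rel.
Proof. by move=> x y; apply/idP/idP; apply: coset_rel_imply. Qed.

Lemma coset_rel_trans : transitive coset_rel.
Proof.
move=> y x z /asboolP Nxy /asboolP Nyz; apply/asboolP.
by have := nsubM Nxy Nyz; rewrite -mulgA mulVKg.
Qed.

Canonical coset_equiv :=
  EquivRel coset_rel coset_rel_refl coset_rel_sym coset_rel_trans.

Definition nsub_quotient := {eq_quot coset_equiv}.

HB.instance Definition _ := Choice.on nsub_quotient.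
HB.instance Definition _ := EqQuotient.on nsub_quotient.

Local Notation Q := nsub_quotient.
Local Notation cls := (\pi_(Q)%qT).

Definition qone : Q := cls 1.
Definition qmul (x y : Q) : Q := cls (repr x * repr y).
Definition qinv (x : Q) : Q := cls (repr x)^-1.

Lemma clsE x y : (cls x = cls y) <-> N (x^-1 * y).
Proof.
split=> [/eqmodP/asboolP // | Nxy].
by apply/eqmodP/asboolP.
Qed.

Lemma repr_cls x : N ((repr (cls x))^-1 * x).
Proof. by apply/clsE; rewrite reprK. Qed.

Lemma qmulE x y : qmul (cls x) (cls y) = cls (x * y).
Proof.
apply/clsE; set x' := repr _; set y' := repr _.
have -> : (x' * y')^-1 * (x * y) = (x'^-1 * x) ^ y' * (y'^-1 * y).
  by rewrite conjgE invgM !mulgA mulgK.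
by apply: nsubM; [apply: nsubJ|]; apply: repr_cls.
Qed.

Lemma qinvE x : qinv (cls x) = cls x^-1.
Proof.
apply/clsE; set x' := repr _.
have -> : x'^-1^-1 * x^-1 = ((x'^-1 * x) ^ x'^-1)^-1.
  by rewrite conjgE !invgK !mulgA mulgV mul1g invgM invgK.
by apply/nsubV/nsubJ/repr_cls.
Qed.

Lemma qmulA : associative qmul.
Proof.
elim/quotW=> x; elim/quotW=> y; elim/quotW=> z.
by rewrite (qmulE y z) (qmulE x y) (qmulE x) qmulE mulgA.
Qed.

Lemma qmul1 : left_id qone qmul.
Proof. by elim/quotW=> x; rewrite /qone qmulE mul1g. Qed.

Lemma qmulg1 : right_id qone qmul.
Proof. by elim/quotW=> x; rewrite /qone qmulE mulg1. Qed.

Lemma qmulV : left_inverse qone qinv qmul.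
Proof. by elim/quotW=> x; rewrite qinvE qmulE mulVg. Qed.

Lemma qmulgV : right_inverse qone qinv qmul.
Proof. by elim/quotW=> x; rewrite qinvE qmulE mulgV. Qed.

HB.instance Definition _ :=
  isGroup.Build nsub_quotient qmulA qmul1 qmulg1 qmulV qmulgV.

End QuotientGroup.

Fixpoint upper_central (H : groupType) (c : nat) (x : H) : Prop :=
  if c is c'.+1 then forall y : H, upper_central c' [~ x, y] else x = 1.

Section UpperCentral.

Variable H : groupType.

Lemma commMgJ_group (x y z : H) : [~ x * y, z] = [~ x, z] ^ y * [~ y, z].
Proof. by rewrite !commgEr conjgM mulgA -conjMg mulgK. Qed.

Lemma upper_central_normal c :
  [/\ upper_central c (1 : H),
      forall x y : H, upper_central c x -> upper_central c y ->
        upper_central c (x * y),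
      forall x : H, upper_central c x -> upper_central c x^-1
    & forall x y : H, upper_central c x -> upper_central c (x ^ y)].
Proof.
elim: c => [|c [Z1 ZM ZV ZJ]] /=.
  split=> // [x y -> -> | x -> | x y ->]; first by rewrite mulg1.
    by rewrite invg1.
  by rewrite conj1g.
split=> [y | x y Zx Zy z | x Zx y | x y Zx z].
- by rewrite comm1g.
- by rewrite commMgJ_group; apply: ZM => //; apply: ZJ.
- have -> : [~ x^-1, y] = ([~ x, y] ^ x^-1)^-1.
    apply: (mulgI ([~ x, y] ^ x^-1)).
    by rewrite mulgV -commMgJ_group mulgV comm1g.
  by apply/ZV/ZJ.
- have -> : [~ x ^ y, z] = [~ x, z ^ y^-1] ^ y by rewrite conjRg conjgKV.
  exact: ZJ.
Qed.

Definition ucs (c : nat) : normalSubgroup H :=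
  let: And4 Z1 ZM ZV ZJ := upper_central_normal c in
  @NormalSubgroup H (@upper_central H c) Z1 ZM ZV ZJ.

End UpperCentral.

Definition isomorphic (G K : groupType) : Prop :=
  exists f : {multiplicative G -> K}, bijective f.

Definition capable (c : nat) (G : groupType) : Prop :=
  exists H : groupType, isomorphic G (nsub_quotient (ucs H c)).

(* In the presentations below, [G \isog Grp (...)] says that G is isomorphic   *)
(* to the largest finite quotient of the presented group.  Every presented     *)
(* group here is finite when the conditions attached to its parameters hold:   *)
(* its commutator subgroup is central and cyclic of finite order, and a and b  *)
(* have finite order.  So under these conditions G is isomorphic to the        *)
(* presented group itself.                                                     *)

Inductive odd_index :=
  | I1 (alpha : nat)
  | I2 (alpha gamma : nat)
  | I3 (alpha beta gamma sigma : nat).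

Definition odd_admissible (i : odd_index) : Prop :=
  match i with
  | I1 alpha => (1 <= alpha)%N
  | I2 alpha gamma => (1 <= gamma)%N /\ (gamma < alpha)%N
  | I3 alpha beta gamma sigma =>
      [/\ (1 <= gamma)%N, (gamma <= beta)%N, (beta <= alpha)%N,
          (alpha - beta = gamma - sigma)%N & (0 <= sigma < gamma)%N]
  end.

Definition iso_odd (p : nat) (i : odd_index)
    (gT : finGroupType) (G : {group gT}) : Prop :=
  match i with
  | I1 alpha =>
      G \isog Grp (a : b : ([~ a, b] ^+ (p ^ alpha)%N = 1,
        a ^+ (p ^ alpha)%N = 1, b ^+ (p ^ alpha)%N = 1,
        [~ a, b, b] = 1, [~ a, b, a] = 1))
  | I2 alpha gamma =>
      G \isog Grp (a : b : ([~ a, b] ^+ (p ^ gamma)%N = 1,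
        a ^+ (p ^ alpha)%N = 1, b ^+ (p ^ alpha)%N = 1,
        [~ a, b, b] = 1, [~ a, b, a] = 1))
  | I3 alpha beta gamma sigma =>
      G \isog Grp (a : b : ([~ a, b] ^+ (p ^ gamma)%N = 1,
        a ^+ (p ^ alpha)%N = 1, [~ a, b, b] = 1, [~ a, b, a] = 1,
        b ^+ (p ^ beta)%N = [~ a, b] ^+ (p ^ sigma)%N))
  end.

Inductive even_index :=
  | I4 (beta : nat)
  | I5 (beta : nat)
  | I6 (alpha gamma : nat)
  | I7 (alpha beta gamma sigma : nat).

(* The boolean [beta == gamma], coerced to nat, is the Kronecker delta.        *)
Definition even_admissible (i : even_index) : Prop :=
  match i with
  | I4 beta => (1 <= beta)%N
  | I5 beta => (1 <= beta)%N
  | I6 alpha gamma => (1 <= gamma)%N /\ (gamma < alpha)%N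
  | I7 alpha beta gamma sigma =>
      [/\ (1 <= gamma)%N /\ (gamma <= beta)%N, (0 <= sigma)%N,
          (alpha - beta > (beta == gamma))%N,
          (alpha - beta = gamma - sigma)%N
        & (beta < alpha)%N /\ (sigma < gamma)%N]
  end.

Definition iso_even (i : even_index)
    (gT : finGroupType) (G : {group gT}) : Prop :=
  match i with
  | I4 beta =>
      G \isog Grp (a : b : ([~ a, b] ^+ (2 ^ beta)%N = 1,
        a ^+ (2 ^ beta)%N = 1, b ^+ (2 ^ beta)%N = 1,
        [~ a, b, b] = 1, [~ a, b, a] = 1))
  | I5 beta =>
      G \isog Grp (a : b : ([~ a, b] ^+ (2 ^ beta)%N = 1,
        a ^+ (2 ^ beta.+1)%N = 1, b ^+ (2 ^ beta)%N = 1,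
        [~ a, b, b] = 1, [~ a, b, a] = 1))
  | I6 alpha gamma =>
      G \isog Grp (a : b : ([~ a, b] ^+ (2 ^ gamma)%N = 1,
        a ^+ (2 ^ alpha)%N = 1, b ^+ (2 ^ alpha)%N = 1,
        [~ a, b, b] = 1, [~ a, b, a] = 1))
  | I7 alpha beta gamma sigma =>
      G \isog Grp (a : b : ([~ a, b] ^+ (2 ^ gamma)%N = 1,
        a ^+ (2 ^ alpha)%N = 1, [~ a, b, b] = 1, [~ a, b, a] = 1,
        b ^+ (2 ^ beta)%N = [~ a, b] ^+ (2 ^ sigma)%N))
  end.

(* Main.v *)
From HB Require Import structures.
Require Import Defs.
From mathcomp Require Import all_boot all_fingroup all_algebra all_solvable.
From mathcomp Require Import generic_quotient ring zify.

Set Implicit Arguments.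
Unset Strict Implicit.
Unset Printing Implicit Defensive.

Local Open Scope group_scope.

(* Write G/G' = C_m x C_n with m = p^alpha >= n = p^beta, |G'| = q = p^gamma,  *)
(* and lift the generators a, b of G = H/Z_2(H) to x, y in H.  Put             *)
(* c = [x,y].  Since H' centralises Z_2(H), an element w lies in Z_2(H) iff    *)
(* [w,s,t] = 1 for s, t in {x,y}, and for w = x^i c^l or y^i c^l these         *)
(* commutators are words in [c,x], [c,y], [c,x,x], [c,x,y], [c,y,y].  The      *)
(* relations a^m = c^-l, b^n = c^k, and the fact that no smaller power of a    *)
(* lies in G', then force a^m = 1 and pin down the p-part of k; when p = 2     *)
(* and beta = gamma the binomial terms do not vanish, which accounts for the   *)
(* exceptional families.  In every case the triple (alpha, beta, gamma)        *)
(* determines the group.                                                       *)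
(*                                                                             *)
(* Conversely let d be a second generator, besides a, such that                *)
(* a^e = 1 <-> d^e [d,a]^C(e,2) = 1, with <a> meeting <d,[d,a]> trivially; d   *)
(* is b, or ba for G_4.  Let x act on Z^4 as the unipotent Jordan block and    *)
(* divide <x> |x Z^4 by the relations between d and [d,a], read in the last    *)
(* two coordinates.  The quotient H satisfies H/Z_2(H) = G.                    *)

(** * Two-generator groups of class two and their presentations *)

(** A group satisfying the relations of a family has order at most [m * n * q] ([card_pres]), and a
    quotient of C_m x C_m times a Heisenberg group attains this bound ([model_presentation]). So
    each family becomes a tuple of exponents, and a presented group has generators [a], [b] that are
    [tight]. The exponent of G/G', the order of G' and the order of G give back alpha, gamma and
    beta ([exponents_unique]); among admissible indices these three fix the index, whence
    uniqueness.

    Necessity: for G = H/Z_2(H), [capable2_criterion] translates each relation of G into identities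
    in H between [c,x], [c,y] and central commutators of weight four. Comparing the identities of
    a^m and b^n yields a^m = 1 and the p-adic valuation of k ([capable_valuation]); raising [a] to a
    power prime to p then normalises k ([pres_valuation]). The binomial corrections vanish modulo q
    except for p = 2 and beta = gamma, where alpha = beta and alpha = beta + 1 need their own
    arguments ([capable_even_balanced], [capable_even_near]). [capable_pres] collects the cases.

    Sufficiency: [capable2_split] constructs H as soon as a^e = 1 is equivalent to d^e [d,a]^C(e,2)
    = 1. For d = b this says that k - C(n,2) has additive order m/n modulo q, which
    [good_exponents_capable] checks. *)

Section CentralCommutator.

Variables (gT : finGroupType) (G : {group gT}) (a b : gT).
Hypotheses (defG : G :=: <[a]> <*> <[b]>).
Hypotheses (cca : commute [~ a, b] a) (ccb : commute [~ a, b] b).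
Local Notation c := [~ a, b].

Lemma mem_gen2 : (a \in G) * (b \in G) * (c \in G).
Proof.
have Ga : a \in G by rewrite defG mem_gen // inE cycle_id.
have Gb : b \in G by rewrite defG mem_gen // inE cycle_id orbT.
by split; [split | rewrite groupR].
Qed.

Lemma cent_commutator : c \in 'C(G).
Proof.
by rewrite -sub_cent1 defG join_subG !cycle_subG; apply/andP; split;
  apply/cent1P.
Qed.

Lemma der1_gen2 : G^`(1) = <[c]>.
Proof.
by rewrite defG; apply: der1_joing_cycles; rewrite -defG cent_commutator.
Qed.

Lemma der1_gen2_sub_center : G^`(1) \subset 'Z(G).
Proof.
by rewrite der1_gen2 cycle_subG inE cent_commutator mem_gen2.
Qed.

Lemma quotient_gen2 :
  G / G^`(1) = <[coset G^`(1) a]> * <[coset G^`(1) b]>.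
Proof.
have nG : {subset G <= 'N(G^`(1))} by apply/subsetP; apply: gFnorm.
have -> : G / G^`(1) = (<[a]> <*> <[b]>) / G^`(1) by rewrite -defG.
rewrite quotientY ?cycle_subG ?nG ?mem_gen2 //.
rewrite !quotient_cycle ?nG ?mem_gen2 // cent_joinEl // cycle_subG.
have/centsP/(_ (coset _ a)): abelian (G / G^`(1)) by apply: der_abelian.
rewrite mem_quotient ?mem_gen2 // => /(_ isT) caQ.
rewrite -sub_cent1 cycle_subG; apply/cent1P/commute_sym/caQ.
by rewrite mem_quotient ?mem_gen2.
Qed.

Lemma coset_der1E i j :
  (coset G^`(1) a ^+ i * coset G^`(1) b ^+ j == 1) =
  (a ^+ i * b ^+ j \in <[c]>).
Proof.
have nG : {subset G <= 'N(G^`(1))} by apply/subsetP; apply: gFnorm.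
rewrite -!morphX ?nG ?mem_gen2 // -morphM ?nG ?groupX ?mem_gen2 //.
rewrite -der1_gen2 /=; apply/eqP/idP; last exact: coset_id.
by move/coset_idr; apply; rewrite nG // groupM ?groupX ?mem_gen2.
Qed.

Lemma gen2_normal_form g : g \in G ->
  exists i j l, g = a ^+ i * b ^+ j * c ^+ l.
Proof.
have nG : {subset G <= 'N(G^`(1))} by apply/subsetP; apply: gFnorm.
move=> Gg; have: coset G^`(1) g \in G / G^`(1) by rewrite mem_quotient.
rewrite quotient_gen2 => /imset2P[_ _ /cycleP[i ->] /cycleP[j ->]].
rewrite -!morphX ?nG ?mem_gen2 // -morphM ?nG ?groupX ?mem_gen2 //= => defg.
have: (a ^+ i * b ^+ j)^-1 * g \in <[c]>.
  rewrite -der1_gen2; apply: coset_idr.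
    by rewrite nG // groupM // groupV groupM ?groupX ?mem_gen2.
  have Gw : a ^+ i * b ^+ j \in G by rewrite groupM ?groupX ?mem_gen2.
  by rewrite morphM ?groupV ?nG // morphV ?nG //= defg mulVg.
case/cycleP=> l def_l; exists i, j, l.
by rewrite -def_l mulKVg.
Qed.

End CentralCommutator.

(** * Orders of presented groups and tight generators *)

Section Presentation.

Variables (m n q k : nat).

Definition pres_gens (gT : finGroupType) (K : {set gT}) (a b : gT) :=
  [/\ K = <[a]> <*> <[b]>, a ^+ m = 1, b ^+ n = [~ a, b] ^+ k,
      [~ a, b] ^+ q = 1
    & commute [~ a, b] a /\ commute [~ a, b] b].

Definition pres (gT : finGroupType) (K : {set gT}) :=
  exists a b, pres_gens K a b.

(** The property that [G \isog Grp (...)] unfolds to, stated for all four-parameter relations at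
    once; [isoGrp_presents] makes the link. *)
Definition presents (gT : finGroupType) (G : {group gT}) :=
  forall (rT : finGroupType) (K : {group rT}), K \homg G <-> pres K.

(* Says that the elements a^i b^j [a,b]^l with i < m, j < n, l < q are         *)
(* pairwise distinct.                                                          *)
Definition tight (gT : finGroupType) (a b : gT) :=
  #[[~ a, b]] = q /\
  forall i j, a ^+ i * b ^+ j \in <[[~ a, b]]> -> m %| i /\ n %| j.

Section Order.

Hypotheses (m_gt0 : 0 < m) (n_gt0 : 0 < n) (q_gt0 : 0 < q).
Variables (gT : finGroupType) (G : {group gT}) (a b : gT).
Hypothesis Gab : pres_gens G a b.

Let Q := coset G^`(1).

Lemma order_coset_dvd : (#[Q a] %| m) && (#[Q b] %| n).
Proof.
case: Gab => defG am bn cq [cca ccb].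
rewrite !order_dvdn; apply/andP; split.
  have := coset_der1E defG cca ccb m 0; rewrite mulg1 => ->.
  by rewrite am mul1g group1.
have := coset_der1E defG cca ccb 0 n; rewrite mul1g => ->.
by rewrite bn mul1g mem_cycle.
Qed.

Lemma card_gen2 :
  (#|G| * #|<[Q a]> :&: <[Q b]>| = #[[~ a, b]] * (#[Q a] * #[Q b]))%N.
Proof.
case: Gab => defG am bn cq [cca ccb].
have:= mul_cardG <[Q a]> <[Q b]>.
rewrite -!orderE => ->; rewrite mulnA; congr (_ * _)%N.
rewrite -(Lagrange (der_sub 1 G)) -card_quotient ?der_norm //.
rewrite (quotient_gen2 defG) //; congr (_ * _)%N.
by rewrite [in RHS]orderE -(der1_gen2 defG).
Qed.

Lemma card_pres : #|G| <= m * n * q.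
Proof.
case: Gab => defG am bn cq [cca ccb].
have /andP[am' bn'] := order_coset_dvd.
have cq' : #[[~ a, b]] %| q by rewrite order_dvdn cq.
apply: (@leq_trans (#|G| * #|<[Q a]> :&: <[Q b]>|)).
  by rewrite leq_pmulr // cardG_gt0.
by rewrite card_gen2 mulnC !leq_mul // dvdn_leq.
Qed.

(** By [card_gen2] the order is a product of three orders, bounded by q, m and n, divided by the
    order of an intersection. It is maximal exactly when every bound is attained and the
    intersection is trivial. *)
Lemma card_tight : tight a b <-> #|G| = (m * n * q)%N.
Proof.
case: Gab => defG am bn cq [cca ccb].
have /andP[am' bn'] := order_coset_dvd.
have cq' : #[[~ a, b]] %| q by rewrite order_dvdn cq.
split=> [[oc tab] | oG].
  have oa : #[Q a] = m.
    apply/eqP; rewrite eqn_dvd am'; case: (tab #[Q a] 0) => //.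
    by rewrite -(coset_der1E defG) // expg_order mul1g.
  have ob : #[Q b] = n.
    apply/eqP; rewrite eqn_dvd bn'; case: (tab 0 #[Q b]) => //.
    by rewrite -(coset_der1E defG) // expg_order mul1g.
  have tiQ : <[Q a]> :&: <[Q b]> = 1.
    apply/trivgP/subsetP=> _ /setIP[/cycleP[i ->] /cycleP[j eqij]].
    (* The exponent [n * j - j] stands for -j, since [Q b] has order n. *)
    rewrite inE -order_dvdn oa; case: (tab i (n * j - j)) => //.
    rewrite -(coset_der1E defG) // -/Q eqij -expgD subnKC ?leq_pmull //.
    by rewrite expgM -ob expg_order expg1n.
  by have:= card_gen2; rewrite tiQ cards1 oa ob oc muln1 mulnC.
have:= card_gen2; rewrite oG => oQ.
have tiQ_gt0 := cardG_gt0 (<[Q a]> :&: <[Q b]>).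
have [oa ob oc] : [/\ #[Q a] = m, #[Q b] = n & #[[~ a, b]] = q].
  have := dvdn_leq m_gt0 am'; have := dvdn_leq n_gt0 bn'.
  have := dvdn_leq q_gt0 cq'.
  have := order_gt0 (Q a); have := order_gt0 (Q b).
  move: (#[Q a]) (#[Q b]) (#[[~ a, b]]) (#|_ :&: _|) oQ tiQ_gt0 => x y z t.
  move=> E t0 y0 x0 zq yn xm.
  have E' : m * n * q <= z * (x * y) by rewrite -E leq_pmulr.
  have le1 : z * (x * y) <= q * (x * y) by rewrite leq_mul.
  have xy : (x * y = m * n)%N.
    apply/eqP; rewrite eqn_leq leq_mul //= -(leq_pmul2r q_gt0).
    by rewrite (leq_trans E') // mulnC leq_mul.
  have xm' : x = m.
    apply/eqP; rewrite eqn_leq xm /= -(leq_pmul2r n_gt0) -xy leq_mul //.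
  have yn' : y = n by apply/eqP; move/eqP: xy; rewrite xm' eqn_pmul2l.
  split=> //; apply/eqP; rewrite eqn_leq zq /=.
  by move: E'; rewrite xy mulnC leq_pmul2r // muln_gt0 m_gt0.
move: oQ; rewrite oa ob oc mulnC (mulnC q) -{2}[(m * n * q)%N]mul1n.
move/eqP; rewrite eqn_pmul2r ?muln_gt0 ?m_gt0 ?n_gt0 // => /eqP/card1_trivg tiQ.
split=> // i j; rewrite -(coset_der1E defG) // -/Q => /eqP eqij.
have Qai : Q a ^+ i = 1.
  apply/set1P; rewrite -[[set 1]]tiQ inE mem_cycle /=.
  by move/(canRL (mulgK _)): eqij; rewrite mul1g => ->; rewrite groupV mem_cycle.
rewrite -oa -ob !order_dvdn Qai eqxx; split=> //.
by rewrite -eqij Qai mul1g.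
Qed.

End Order.

Lemma pres_homg (gT rT : finGroupType) (G : {group gT}) (K : {group rT}) :
  K \homg G -> pres G -> pres K.
Proof.
case/homgP=> f <- [a [b [defG am bn cq [cca ccb]]]].
have [[Ga Gb] Gc] := mem_gen2 defG.
exists (f a), (f b); split; rewrite -?morphR -?morphX //.
- have -> : f @* G = f @* (<[a]> <*> <[b]>) by rewrite -defG.
  by rewrite morphimY ?cycle_subG // !morphim_cycle.
- by rewrite am morph1.
- by rewrite bn.
- by rewrite cq morph1.
- by split; rewrite /commute -!morphM // (cca, ccb).
Qed.

(* A group K satisfying the relations and G both are images of the subgroup of *)
(* G x K generated by the pairs of generators; that subgroup satisfies the     *)
(* relations as well, so it is no larger than G.                               *)
Lemma presents_card (gT : finGroupType) (G : {group gT}) :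
    0 < m -> 0 < n -> 0 < q -> pres G -> #|G| = (m * n * q)%N ->
  presents G.
Proof.
move=> m_gt0 n_gt0 q_gt0 presG oG rT K; split=> [homK|].
  exact: pres_homg presG.
case: presG => [a [b [defG am bn cq [cca ccb]]]].
case=> [a' [b' [defK am' bn' cq' [cca' ccb']]]].
pose x := (a, a'); pose y := (b, b').
pose S := (<[x]> <*> <[y]>)%G.
have mulE (u u' : gT) (v v' : rT) : (u, v) * (u', v') = (u * u', v * v') by [].
have expE (u : gT) (v : rT) i : (u, v) ^+ i = (u ^+ i, v ^+ i).
  by elim: i => // i IH; rewrite !expgS IH.
have Rxy : [~ x, y] = ([~ a, b], [~ a', b']) by [].
have presS : pres_gens S x y.
  split; rewrite ?Rxy ?expE ?am ?am' ?bn ?bn' ?cq ?cq' //.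
  by split; rewrite /commute !mulE (cca, ccb) (cca', ccb').
have leS := card_pres m_gt0 n_gt0 q_gt0 presS.
have hom1 : {morph (fst : gT * rT -> gT) : u v / u * v} by [].
have hom2 : {morph (snd : gT * rT -> rT) : u v / u * v} by [].
pose f1 := Morphism (D := [set: gT * rT]) (fun u v _ _ => hom1 u v).
pose f2 := Morphism (D := [set: gT * rT]) (fun u v _ _ => hom2 u v).
have im1 : f1 @* S = G.
  by rewrite morphimY ?subsetT // !morphim_cycle ?inE //= defG.
have im2 : f2 @* S = K.
  by rewrite morphimY ?subsetT // !morphim_cycle ?inE //= defK.
have homKS : K \homg S.
  apply/homgP; exists (restrm (subsetT S) f2).
  by rewrite morphim_restrm setIid.
have isoGS : G \isog S.
  rewrite isogEcard oG leS andbT; apply/homgP.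
  by exists (restrm (subsetT S) f1); rewrite morphim_restrm setIid.
by rewrite (eq_homgr K isoGS).
Qed.

End Presentation.

(* C_m x C_m times the Heisenberg group modulo q.  Its quotient by the central *)
(* cyclic subgroup generated by b^n c^-k realises the presentation.            *)
Definition cyclic_heis (m q : nat) := ('Z_m * 'Z_m * 'Z_q * 'Z_q * 'Z_q)%type.

HB.instance Definition _ m q := Finite.on (cyclic_heis m q).

Section CyclicHeisenberg.

Variables m q : nat.
Local Notation E := (cyclic_heis m q).

Local Open Scope ring_scope.

Definition ch_mul (u v : E) : E :=
  let: (i, j, x, y, z) := u in let: (i', j', x', y', z') := v in
  (i + i', j + j', x + x', y + y', z + z' + x * y').

Definition ch_one : E := (0, 0, 0, 0, 0).

Definition ch_inv (u : E) : E :=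
  let: (i, j, x, y, z) := u in (- i, - j, - x, - y, x * y - z).

Lemma ch_mulA : associative ch_mul.
Proof.
by move=> [[[[i j] x] y] z] [[[[i1 j1] x1] y1] z1] [[[[i2 j2] x2] y2] z2];
  rewrite /ch_mul; congr (_, _, _, _, _); ring.
Qed.

Lemma ch_mul1 : left_id ch_one ch_mul.
Proof.
by move=> [[[[i j] x] y] z]; rewrite /ch_mul; congr (_, _, _, _, _); ring.
Qed.

Lemma ch_mulV : left_inverse ch_one ch_inv ch_mul.
Proof.
by move=> [[[[i j] x] y] z]; rewrite /ch_mul; congr (_, _, _, _, _); ring.
Qed.

HB.instance Definition _ := Finite_isGroup.Build E ch_mulA ch_mul1 ch_mulV.

End CyclicHeisenberg.

(** * A group of full order satisfying the relations *)

Section Model.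

Variables m n q k : nat.
Hypotheses (m_gt1 : 1 < m) (q_gt1 : 1 < q).
Hypotheses (n_dvd_m : n %| m) (q_dvd_n : q %| n) (q_dvd_k : q %| k * (m %/ n)).

Local Notation E := (cyclic_heis m q).
Import GRing.Theory.

Let a : E := (1, 0, 1, 0, 0)%R.
Let b : E := (0, 1, 0, 1, 0)%R.
Let c : E := (0, 0, 0, 0, 1)%R.
Let z : E := (0, n%:R, 0, 0, - k%:R)%R.

Local Lemma Zp_nat_eq0 t i : 1 < t -> (i%:R == 0 :> 'Z_t)%R = (t %| i).
Proof. by move=> t_gt1; rewrite -val_eqE /= val_Zp_nat. Qed.

Local Lemma model_mulE (u v : E) : u * v = ch_mul u v. Proof. by []. Qed.

Local Lemma model_aX i : a ^+ i = (i%:R, 0, i%:R, 0, 0)%R :> E.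
Proof.
elim: i => // i IH; rewrite expgS IH model_mulE /=.
by congr (_, _, _, _, _); ring.
Qed.

Local Lemma model_bX i : b ^+ i = (0, i%:R, 0, i%:R, 0)%R :> E.
Proof.
elim: i => // i IH; rewrite expgS IH model_mulE /=.
by congr (_, _, _, _, _); ring.
Qed.

Local Lemma model_cX i : c ^+ i = (0, 0, 0, 0, i%:R)%R :> E.
Proof.
elim: i => // i IH; rewrite expgS IH model_mulE /=.
by congr (_, _, _, _, _); ring.
Qed.

Local Lemma model_zX i : z ^+ i = (0, (n * i)%:R, 0, 0, - (k * i)%:R)%R :> E.
Proof.
elim: i => [|i IH]; first by rewrite !muln0 oppr0.
by rewrite expgS IH model_mulE /= !mulnS !natrD; congr (_, _, _, _, _); ring.
Qed.

Local Lemma model_R : [~ a, b] = c.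
Proof.
apply: (mulgI (b * a)); rewrite -commgC !model_mulE /=.
by congr (_, _, _, _, _); ring.
Qed.

Local Lemma model_central (u v : E) : u \in [:: c; z] -> commute u v.
Proof.
case: v => [[[[i j] x] y] w]; rewrite !inE /commute => /pred2P[] ->;
  by rewrite !model_mulE /=; congr (_, _, _, _, _); ring.
Qed.

(** When z^t has trivial second coordinate, m/n divides t, so q divides k t by [q_dvd_k]. Hence <z>
    meets <c> trivially, and the quotient by <z> keeps the order of c. *)
Local Lemma model_mem_z i j l : a ^+ i * b ^+ j * c ^+ l \in <[z]> ->
  [/\ m %| i, n %| j & i = 0 -> j = 0 -> q %| l].
Proof.
rewrite model_aX model_bX model_cX !model_mulE /= !(mulr0, addr0, add0r).
have eqZ t x y : 1 < t -> (x%:R = y%:R :> 'Z_t)%R -> x = y %[mod t].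
  by move=> t_gt1 /(congr1 val) /=; rewrite !val_Zp_nat.
case/cycleP=> t; rewrite model_zX => eqE.
have [/= ei /= ej] := (congr1 (fun u : E => u.1.1.1.1) eqE,
                 congr1 (fun u : E => u.1.1.1.2) eqE).
have {eqE} /= ez := congr1 (fun u : E => u.2) eqE.
split; first by rewrite -Zp_nat_eq0 // ei.
  have := eqZ _ _ _ m_gt1 ej; rewrite /dvdn -(modn_dvdm j n_dvd_m) => ->.
  by rewrite modn_dvdm // modnMr.
move=> i0 j0; have n_gt0 : 0 < n by apply: dvdn_gt0 n_dvd_m; apply: ltnW.
have q_dvd_kt : q %| k * t.
  have : m %| n * t by rewrite -Zp_nat_eq0 // -ej j0.
  rewrite -{1}(divnK n_dvd_m) mulnC dvdn_pmul2l // => /(dvdn_mul (dvdnn k)).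
  exact: dvdn_trans.
rewrite -(dvdn_addl l q_dvd_kt) -Zp_nat_eq0 // natrD.
have : (l%:R = - (k * t)%:R :> 'Z_q)%R.
  by rewrite -ez i0 mul0r add0r.
by move=> ->; rewrite addNr.
Qed.

Lemma model_presentation : exists (rT : finGroupType) (K : {group rT}),
  pres m n q k K /\ #|K| = (m * n * q)%N.
Proof.
have n_gt0 : 0 < n by apply: dvdn_gt0 n_dvd_m; apply: ltnW.
have nzE u : u \in 'N(<[z]>).
  rewrite (subsetP (cent_sub _)) // -sub_cent1 cycle_subG; apply/cent1P.
  by apply: model_central; rewrite !inE eqxx orbT.
have commE (u : E) : commute c u by apply: model_central; rewrite inE eqxx.
pose f := coset <[z]>.
have fM u v : f (u * v) = f u * f v by rewrite /f morphM ?nzE.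
have fX u i : f (u ^+ i) = f u ^+ i by rewrite /f morphX ?nzE.
have fR u v : f [~ u, v] = [~ f u, f v] by rewrite /f morphR ?nzE.
have fone : f 1 = 1 by rewrite /f morph1.
have f1 u : f u = 1 -> u \in <[z]> by move/coset_idr; apply.
have am : a ^+ m = 1.
  rewrite model_aX; congr (_, _, _, _, _); apply/eqP; rewrite Zp_nat_eq0 //.
  by rewrite (dvdn_trans q_dvd_n).
have bn : b ^+ n = z * c ^+ k.
  rewrite model_bX model_cX model_mulE /=.
  have -> : (n%:R = 0 :> 'Z_q)%R by apply/eqP; rewrite Zp_nat_eq0.
  by congr (_, _, _, _, _); ring.
have cq : c ^+ q = 1.
  rewrite model_cX; congr (_, _, _, _, _); apply/eqP; rewrite Zp_nat_eq0 //.
exists (coset_of <[z]>), (<[f a]> <*> <[f b]>)%G.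
have Kab : pres_gens m n q k (<[f a]> <*> <[f b]>)%G (f a) (f b).
  split; rewrite // -?fR ?model_R -?fX ?am ?bn ?cq ?fM //.
  - by rewrite [f z]coset_id ?cycle_id // mul1g.
  - by rewrite /commute -!fM !commE.
split; first by exists (f a), (f b).
apply/(card_tight _ n_gt0 _ Kab); rewrite ?(ltnW m_gt1) ?(ltnW q_gt1) //.
rewrite /tight -fR model_R; split.
  apply/eqP; rewrite eqn_dvd order_dvdn -fX cq fone eqxx /=.
  have: a ^+ 0 * b ^+ 0 * c ^+ #[f c] \in <[z]>.
    by rewrite !mul1g f1 // fX expg_order.
  by case/model_mem_z=> _ _; apply.
move=> i j; rewrite -!fX -fM => /cycleP[l def_l].
have l_le : l <= q * l by rewrite leq_pmull // ltnW.
have: a ^+ i * b ^+ j * c ^+ (q * l - l) \in <[z]>.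
  by rewrite f1 // fM def_l -fX -fM -expgD subnKC // expgM cq expg1n fone.
by case/model_mem_z.
Qed.

(** The model is an image of G, so G has order at least [m * n * q]; [card_pres] gives the other
    inequality. *)
Lemma presents_tight (gT : finGroupType) (G : {group gT}) :
  presents m n q k G ->
  exists a b, pres_gens m n q k G a b /\ tight m n q a b.
Proof.
move=> presG; have n_gt0 : 0 < n by apply: dvdn_gt0 n_dvd_m; apply: ltnW.
have [rT [K [/presG homKG oK]]] := model_presentation.
have [x [y Gxy]] : pres m n q k G by apply/presG/homg_refl.
have [m_gt0 q_gt0] := (ltnW m_gt1, ltnW q_gt1).
exists x, y; split=> //; apply/(card_tight m_gt0 n_gt0 q_gt0 Gxy)/eqP.
rewrite eqn_leq (card_pres m_gt0 n_gt0 q_gt0 Gxy) -oK dvdn_leq ?cardG_gt0 //.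
exact: card_homg.
Qed.

End Model.

(** * From [Grp] presentations to tuples of exponents *)

Section GrpPresentation.

Variables (m n q k : nat) (gT : finGroupType) (G : {group gT}).

Lemma homGrp_split_pres :
  G \homg Grp (a : b : ([~ a, b] ^+ q = 1, a ^+ m = 1, b ^+ n = 1,
                        [~ a, b, b] = 1, [~ a, b, a] = 1))
  <-> pres m n q q G.
Proof.
split=> [/existsP[[a b] /= /eqP[defG cq am bn /eqP/commgP ccb /eqP/commgP cca]]|].
  by exists a, b; split; rewrite ?cq.
case=> a [b [defG am bn cq [/commgP/eqP cca /commgP/eqP ccb]]].
apply/existsP; exists (a, b); apply/eqP => /=.
by rewrite -defG cq am bn cq cca ccb.
Qed.

Lemma homGrp_pres :
  G \homg Grp (a : b : ([~ a, b] ^+ q = 1, a ^+ m = 1,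
                        [~ a, b, b] = 1, [~ a, b, a] = 1,
                        b ^+ n = [~ a, b] ^+ k))
  <-> pres m n q k G.
Proof.
split=> [/existsP[[a b] /= /eqP[defG cq am /eqP/commgP ccb /eqP/commgP cca bn]]|].
  by exists a, b; split; rewrite ?cq.
case=> a [b [defG am bn cq [/commgP/eqP cca /commgP/eqP ccb]]].
apply/existsP; exists (a, b); apply/eqP => /=.
by rewrite -defG cq am bn cca ccb.
Qed.

End GrpPresentation.

Lemma isoGrp_split_presents m n q (gT : finGroupType) (G : {group gT}) :
  G \isog Grp (a : b : ([~ a, b] ^+ q = 1, a ^+ m = 1, b ^+ n = 1,
                        [~ a, b, b] = 1, [~ a, b, a] = 1))
  <-> presents m n q q G.
Proof.
split=> isoG rT K; first by rewrite isoG; apply: homGrp_split_pres.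
by apply/idP/idP=> [/isoG/homGrp_split_pres | /homGrp_split_pres/isoG].
Qed.

Lemma isoGrp_presents m n q k (gT : finGroupType) (G : {group gT}) :
  G \isog Grp (a : b : ([~ a, b] ^+ q = 1, a ^+ m = 1,
                        [~ a, b, b] = 1, [~ a, b, a] = 1,
                        b ^+ n = [~ a, b] ^+ k))
  <-> presents m n q k G.
Proof.
split=> isoG rT K; first by rewrite isoG; apply: homGrp_pres.
by apply/idP/idP=> [/isoG/homGrp_pres | /homGrp_pres/isoG].
Qed.

(* The case b^(p^beta) = 1 is recorded as b^(p^beta) = [a,b]^(p^gamma), so     *)
(* that sigma = gamma there.                                                   *)
Definition odd_exponents (i : odd_index) : nat * nat * nat * nat :=
  match i with
  | I1 alpha => (alpha, alpha, alpha, alpha)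
  | I2 alpha gamma => (alpha, alpha, gamma, gamma)
  | I3 alpha beta gamma sigma => (alpha, beta, gamma, sigma)
  end.

Definition even_exponents (i : even_index) : nat * nat * nat * nat :=
  match i with
  | I4 beta => (beta, beta, beta, beta)
  | I5 beta => (beta.+1, beta, beta, beta)
  | I6 alpha gamma => (alpha, alpha, gamma, gamma)
  | I7 alpha beta gamma sigma => (alpha, beta, gamma, sigma)
  end.

Definition presents_exponents p (e : nat * nat * nat * nat)
    (gT : finGroupType) (G : {group gT}) :=
  let: (alpha, beta, gamma, sigma) := e in
  presents (p ^ alpha) (p ^ beta) (p ^ gamma) (p ^ sigma) G.

Lemma iso_oddE p i (gT : finGroupType) (G : {group gT}) :
  iso_odd p i G <-> presents_exponents p (odd_exponents i) G.
Proof.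
case: i => *; [exact: isoGrp_split_presents | exact: isoGrp_split_presents |].
exact: isoGrp_presents.
Qed.

Lemma iso_evenE i (gT : finGroupType) (G : {group gT}) :
  iso_even i G <-> presents_exponents 2 (even_exponents i) G.
Proof.
case: i => *; [| | | exact: isoGrp_presents]; exact: isoGrp_split_presents.
Qed.

(** What the model needs in order to have full order; the last inequality says that q divides
    p^sigma m/n. It does not express capability. *)
Definition good_exponents (e : nat * nat * nat * nat) :=
  let: (alpha, beta, gamma, sigma) := e in
  [&& 0 < gamma, gamma <= beta, beta <= alpha, sigma <= gamma
    & gamma - sigma <= alpha - beta].

Lemma odd_good i : odd_admissible i -> good_exponents (odd_exponents i).
Proof. by case: i => [al|al ga|al be ga si] /=; [| |case=> ????]; lia. Qed.

Lemma even_good i : even_admissible i -> good_exponents (even_exponents i).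
Proof.
by case: i => [be|be|al ga|al be ga si] /=; [| | |case=> -[? ?] ? ? ? [? ?]]; lia.
Qed.

(** * The group determines its exponents *)

Section Uniqueness.

Variables (gT : finGroupType) (G : {group gT}) (p : nat).
Hypothesis p_prime : prime p.

Lemma presents_exponents_tight al be ga si :
    good_exponents (al, be, ga, si) ->
    presents_exponents p (al, be, ga, si) G ->
  exists a b, pres_gens (p ^ al) (p ^ be) (p ^ ga) (p ^ si) G a b
    /\ tight (p ^ al) (p ^ be) (p ^ ga) a b.
Proof.
case/and5P=> ga_gt0 ga_be be_al si_ga gs_ab; apply: presents_tight.
- by rewrite -(expn0 p) ltn_exp2l ?prime_gt1 //; lia.
- by rewrite -(expn0 p) ltn_exp2l ?prime_gt1.
- exact: dvdn_exp2l.
- exact: dvdn_exp2l.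
by rewrite -expnB ?prime_gt0 // -expnD dvdn_exp2l //; lia.
Qed.

(** The abelian group G/G' is generated by elements of orders dividing m', so a^m' lies in G' and
    tightness applies. *)
Lemma tight_dvd m n q k m' n' q' k' (a b a' b' : gT) :
    n' %| m' -> pres_gens m n q k G a b -> tight m n q a b ->
    pres_gens m' n' q' k' G a' b' ->
  m %| m' /\ q = #|G^`(1)|.
Proof.
move=> n'm' Gab [oc tab] Gab'; case: (Gab) => defG am bn cq [cca ccb].
case: (Gab') => defG' am' bn' cq' [cca' ccb'].
split; last by rewrite (der1_gen2 defG).
have: coset G^`(1) a \in G / G^`(1) by rewrite mem_quotient ?(mem_gen2 defG).
rewrite (quotient_gen2 defG') // => /imset2P[_ _ /cycleP[i ->] /cycleP[j ->]] eqa.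
have /andP[oa' ob'] := order_coset_dvd Gab'.
case: (tab m' 0) => //; rewrite -(coset_der1E defG) // mulg1 eqa.
have caQ: commute (coset G^`(1) a') (coset G^`(1) b').
  have/centsP: abelian (G / G^`(1)) by apply: der_abelian.
  by apply; rewrite mem_quotient ?(mem_gen2 defG').
rewrite expgMn; last exact: commuteX2.
have /eqP a'1 : coset G^`(1) a' ^+ m' == 1 by rewrite -order_dvdn.
have /eqP b'1 : coset G^`(1) b' ^+ m' == 1.
  by rewrite -order_dvdn (dvdn_trans ob').
by rewrite !(expgAC _ _ m') a'1 b'1 !expg1n mulg1.
Qed.

(** [tight_dvd] used both ways compares alpha and gamma, and the order of G then compares beta.
    Sigma is left aside: for admissible indices it follows from the other three. *)
Lemma exponents_unique e e' :
    good_exponents e -> good_exponents e' ->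
    presents_exponents p e G -> presents_exponents p e' G ->
  e.1 = e'.1.
Proof.
case: e e' => [[[al be] ga] si] [[[al' be'] ga'] si'] good good' iG iG'.
have [a [b [Gab tab]]] := presents_exponents_tight good iG.
have [a' [b' [Gab' tab']]] := presents_exponents_tight good' iG'.
have exp_gt0 i : 0 < p ^ i by rewrite expn_gt0 prime_gt0.
have [be_al be_al'] : be <= al /\ be' <= al' by move: good good' => /=; lia.
have [m_m' defq] := tight_dvd (dvdn_exp2l _ be_al') Gab tab Gab'.
have [m'_m defq'] := tight_dvd (dvdn_exp2l _ be_al) Gab' tab' Gab.
have inj := expnI (prime_gt1 p_prime).
have /inj eq_al : (p ^ al = p ^ al')%N by apply/eqP; rewrite eqn_dvd m_m'.
have /inj eq_ga : (p ^ ga = p ^ ga')%N by rewrite defq.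
have := (card_tight (exp_gt0 _) (exp_gt0 _) (exp_gt0 _) Gab).1 tab.
rewrite ((card_tight (exp_gt0 _) (exp_gt0 _) (exp_gt0 _) Gab').1 tab').
rewrite -eq_al -eq_ga => /eqP; rewrite eqn_pmul2r // eqn_pmul2l //.
by move=> /eqP/inj <-.
Qed.

End Uniqueness.

Lemma odd_exponents_inj i i' : odd_admissible i -> odd_admissible i' ->
  (odd_exponents i).1 = (odd_exponents i').1 -> i = i'.
Proof.
case: i => [al|al ga|al be ga si]; case: i' => [al'|al' ga'|al' be' ga' si'] /=;
  move=> H H' []; intros; subst; try (by []);
  try (destruct H); try (destruct H'); try lia.
by congr I3; lia.
Qed.

(** The Kronecker delta keeps [I7] apart from [I5]: when beta = gamma it forces alpha - beta to be
    at least 2. *)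
Lemma even_exponents_inj i i' : even_admissible i -> even_admissible i' ->
  (even_exponents i).1 = (even_exponents i').1 -> i = i'.
Proof.
case: i => [be|be|al ga|al be ga si];
  case: i' => [be'|be'|al' ga'|al' be' ga' si'] /=;
  move=> H H' []; intros; subst; try (by []);
  try (destruct H); try (destruct H'); try lia.
by congr I7; lia.
Qed.

(** * Necessity *)

Section GroupCommutators.

Variable H : groupType.
Implicit Types x y z u v w s t : H.

Lemma commgMJ_group x y z : [~ x, y * z] = [~ x, z] * [~ x, y] ^ z.
Proof. by rewrite /commg /conjg !invgM !mulgA !mulgK. Qed.

Lemma commVg_group x y : [~ x^-1, y] = ([~ x, y] ^ x^-1)^-1.
Proof.
by apply: (mulgI ([~ x, y] ^ x^-1)); rewrite mulgV -commMgJ_group mulgV comm1g.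
Qed.

Lemma commgV_group x y : [~ x, y^-1] = ([~ x, y] ^ y^-1)^-1.
Proof. by rewrite -invgR commVg_group invgK -invgR conjVg. Qed.

Lemma commute_conj x y : commute x y -> x ^ y = x.
Proof. by move/commgP/conjg_fixP. Qed.

Lemma commuteR x y z : commute x y -> commute x z -> commute x [~ y, z].
Proof.
by move=> cxy cxz; rewrite /commg /conjg; do !apply: commuteM => //;
  apply: commuteV.
Qed.

End GroupCommutators.

Section SecondCentre.

Variable H : groupType.
Implicit Types x y z u v w s t : H.
Local Notation Z2 := (@upper_central H 2).

Lemma second_centre_comm z s t : Z2 z -> commute [~ z, s] t.
Proof. by move=> Zz; apply/commgP/eqP/Zz. Qed.

Lemma second_centre_commM z s t : Z2 z -> [~ z, s * t] = [~ z, s] * [~ z, t].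
Proof.
move=> Zz; rewrite commgMJ_group commute_conj; last exact: second_centre_comm.
exact: second_centre_comm.
Qed.

(** The map s -> [z,s] is a homomorphism into the centre, so it is trivial on commutators. *)
Lemma second_centre_commute_comm z s t : Z2 z -> commute z [~ s, t].
Proof.
move=> Zz; apply/commgP/eqP; apply: (mulgI [~ z, t * s]).
rewrite -second_centre_commM // -commgC mulg1 !second_centre_commM //.
exact: second_centre_comm.
Qed.

End SecondCentre.

Lemma ucsE (H : groupType) n (x : H) : ucs H n x = upper_central n x.
Proof. by rewrite /ucs; case: upper_central_normal. Qed.

(** Replaces the abstract quotient by a surjection onto G with kernel Z_2(H), along which generators
    can be lifted. *)
Lemma capable2_cover (gT : finGroupType) (G : {group gT}) :
    capable 2 (subg_of G) ->
  exists (H : groupType) (pi : H -> gT),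
    [/\ {morph pi : x y / x * y}, forall x, pi x \in G,
        forall g, g \in G -> exists x, pi x = g
      & forall x, pi x = 1 <-> upper_central 2 x].
Proof.
case=> H [f [f' fK f'K]]; pose cls := \pi_(nsub_quotient (ucs H 2))%qT.
have clsM x y : cls (x * y) = cls x * cls y by rewrite /cls -qmulE.
have f'M : {morph f' : x y / x * y}.
  by move=> x y; apply: (can_inj fK); rewrite gmulfM !f'K.
exists H, (fun x => sgval (f' (cls x))); split.
- by move=> x y; rewrite clsM f'M.
- by move=> x; apply: subgP.
- move=> g Gg; exists (repr (f (subg G g))).
  by rewrite /cls reprK fK subgK.
have f'1 : f' 1 = 1 by apply: (mulgI (f' 1)); rewrite -f'M !mulg1.
have cls1 x : cls x = 1 <-> upper_central 2 x.
  split=> [/esym/clsE|Zx]; first by rewrite invg1 mul1g ucsE.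
  by apply/esym/clsE; rewrite invg1 mul1g ucsE.
move=> x; split=> [f'x|/cls1 ->]; last by rewrite f'1.
by apply/cls1/(can_inj f'K); rewrite f'1; apply: val_inj.
Qed.

(** * Testing membership in the second centre by commutators of weight four *)

Section Criterion.

Variables (gT : finGroupType) (G : {group gT}) (H : groupType) (pi : H -> gT).
Hypotheses (piM : {morph pi : x y / x * y}) (piG : forall x, pi x \in G).
Hypothesis pi1 : forall x, pi x = 1 <-> upper_central 2 x.
Implicit Types u v w s t z : H.
Local Notation Z2 := (@upper_central H 2).

Variables (x y : H).
Hypothesis defG : G :=: <[pi x]> <*> <[pi y]>.
Hypotheses (ccx : commute [~ pi x, pi y] (pi x)).
Hypotheses (ccy : commute [~ pi x, pi y] (pi y)).

Lemma cover1 : pi 1 = 1.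
Proof. by apply: (mulgI (pi 1)); rewrite -piM !mulg1. Qed.

Lemma coverV u : pi u^-1 = (pi u)^-1.
Proof. by apply: (mulgI (pi u)); rewrite -piM !mulgV cover1. Qed.

Lemma coverR u v : pi [~ u, v] = [~ pi u, pi v].
Proof. by rewrite /commg /conjg !piM !coverV. Qed.

Lemma coverX u n : pi (u ^+ n) = pi u ^+ n.
Proof. by elim: n => [|n IH]; rewrite ?cover1 // !expgS piM IH. Qed.

Lemma cover_eq u v : pi u = pi v -> Z2 (u^-1 * v).
Proof. by move=> eq_uv; apply/pi1; rewrite piM coverV eq_uv mulVg. Qed.

Local Notation c := [~ x, y].
Local Notation e1 := [~ c, x].
Local Notation e2 := [~ c, y].

Lemma second_centre_comm3 u v s : Z2 [~ [~ u, v], s].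
Proof.
apply/pi1; rewrite !coverR; apply/eqP/commgP.
have : [~ pi u, pi v] \in 'Z(G).
  by apply: (subsetP (der1_gen2_sub_center defG ccx ccy)); rewrite mem_commg.
by case/centerP=> _; apply.
Qed.

Lemma cover_normal_form u :
  exists i j l z, Z2 z /\ u = x ^+ i * y ^+ j * c ^+ l * z.
Proof.
have [i [j [l def_u]]] := gen2_normal_form defG ccx ccy (piG u).
exists i, j, l, ((x ^+ i * y ^+ j * c ^+ l)^-1 * u); split; last by rewrite mulVKg.
by apply: cover_eq; rewrite !piM !coverX coverR.
Qed.

Lemma commute_cover u s : (forall z, Z2 z -> commute u z) ->
  commute u x -> commute u y -> commute u s.
Proof.
move=> uZ ux uy; have [i [j [l [z [Zz ->]]]]] := cover_normal_form s.
apply: commuteM; last exact: uZ.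
apply: commuteM; first by apply: commuteM; apply: commuteX.
exact/commuteX/commuteR.
Qed.

(** G' is generated by the image of c, so every commutator is a power of c times an element of
    Z_2(H), and the latter commutes with c. *)
Lemma commute_comm_c s t : commute c [~ s, t].
Proof.
have: [~ pi s, pi t] \in <[[~ pi x, pi y]]>.
  by rewrite -(der1_gen2 defG ccx ccy) mem_commg.
case/cycleP=> i; rewrite -!coverR -coverX => eq_st.
rewrite -(mulVKg (c ^+ i) [~ s, t]); apply: commuteM; first exact: commuteX.
exact/commute_sym/second_centre_commute_comm/cover_eq/esym.
Qed.

(** The elements s with [w,s] central form a subgroup. It contains Z_2(H), and by hypothesis x and
    y, hence everything. *)
Lemma second_centre_test w :
    [~ w, x, x] = 1 -> [~ w, x, y] = 1 -> [~ w, y, x] = 1 -> [~ w, y, y] = 1 ->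
  Z2 w.
Proof.
move=> wxx wxy wyx wyy.
pose P s := forall t, commute [~ w, s] t.
have PM s t : P s -> P t -> P (s * t).
  move=> Ps Pt v; rewrite commgMJ_group (commute_conj (Ps t)).
  by apply/commute_sym/commuteM; apply/commute_sym; [apply: Pt | apply: Ps].
have PV s : P s -> P s^-1.
  move=> Ps v; rewrite commgV_group (commute_conj (Ps _)).
  exact/commute_sym/commuteV/commute_sym.
have PX s n : P s -> P (s ^+ n).
  move=> Ps; elim: n => [|n IH].
    by move=> t; rewrite commg1; apply/commute_sym/commute1.
  by rewrite expgS; apply: PM.
have PZ s z : Z2 z -> commute [~ w, s] z.
  by move=> Zz; apply/commute_sym/second_centre_commute_comm.
have Px : P x by move=> t; apply: commute_cover => [z /PZ //||]; apply/commgP/eqP.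
have Py : P y by move=> t; apply: commute_cover => [z /PZ //||]; apply/commgP/eqP.
(* [c] is by definition x^-1 (y^-1 (x y)). *)
have Pc : P c := PM _ _ (PV _ Px) (PM _ _ (PV _ Py) (PM _ _ Px Py)).
move=> s t; apply/eqP/commgP; move: t; rewrite -/(P s).
have [i [j [l [z [Zz ->]]]]] := cover_normal_form s.
apply: (PM _ _ (PM _ _ (PM _ _ (PX _ _ Px) (PX _ _ Py)) (PX _ _ Pc))).
move=> t; rewrite -invgR; apply/commute_sym/commuteV/commute_sym.
exact: second_centre_comm.
Qed.

(* Satisfied by the elements of H'.                                            *)
Definition der_like u :=
  (forall z, Z2 z -> commute z u) /\ forall s, Z2 [~ u, s].

Lemma der_like_comm s t : der_like [~ s, t].
Proof.
by split=> *; [apply: second_centre_commute_comm | apply: second_centre_comm3].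
Qed.

Lemma der_like_commM u v s : der_like u -> der_like v ->
  [~ u * v, s] = [~ u, s] * [~ v, s].
Proof.
by move=> [_ Zu] [Zv _]; rewrite commMgJ_group (commute_conj (Zv _ (Zu s))).
Qed.

Lemma der_likeM u v : der_like u -> der_like v -> der_like (u * v).
Proof.
move=> du dv; have [Zu uZ] := du; have [Zv vZ] := dv.
split=> [z Zz | s]; first by apply: commuteM; [apply: Zu | apply: Zv].
rewrite der_like_commM //; have [_ ZM _ _] := upper_central_normal H 2.
exact: ZM.
Qed.

Lemma der_like1 : der_like 1.
Proof.
split=> [z _|s]; first exact: commute1.
by rewrite comm1g; case: (upper_central_normal H 2).
Qed.

Lemma der_likeX u n : der_like u -> der_like (u ^+ n).
Proof.
move=> du; elim: n => [|n IH]; first exact: der_like1.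
by rewrite expgS; apply: der_likeM.
Qed.

Lemma der_like_commX u n s : der_like u -> [~ u ^+ n, s] = [~ u, s] ^+ n.
Proof.
move=> du; elim: n => [|n IH]; first by rewrite comm1g.
by rewrite !expgS der_like_commM ?IH //; apply: der_likeX.
Qed.

Lemma der_like_commV u s : der_like u -> [~ u^-1, s] = [~ u, s]^-1.
Proof.
case=> Zu uZ; rewrite commVg_group commute_conj //.
exact/commuteV/Zu/uZ.
Qed.

Lemma comm4_central s t v w u : commute [~ [~ [~ s, t], v], w] u.
Proof. exact/second_centre_comm/second_centre_comm3. Qed.

Lemma comm_c_commX n s : [~ [~ c, x ^+ n], s] = [~ e1, s] ^+ n.
Proof.
elim: n => [|n IH]; first by rewrite commg1 comm1g.
rewrite expgSr commgMJ_group der_like_commM; first last.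
- by rewrite conjRg; apply: der_like_comm.
- exact: der_like_comm.
rewrite expgS -IH; congr (_ * _).
rewrite -[_ ^ x](mulVKg [~ c, x ^+ n]) -commgEl commMgJ_group.
rewrite (commute_conj (commute_sym _)); last exact: comm4_central.
have /commgP/eqP-> := comm4_central x y (x ^+ n) x s.
by rewrite mulg1.
Qed.

(** Expanding [x x^n, y] gives the factor c^(x^n) = c [c,x^n], which adds the n-th power of [e1,s];
    Pascal's rule sums these to C(n,2). *)
Lemma comm_powX n s :
  [~ [~ x ^+ n, y], s] = [~ c, s] ^+ n * [~ e1, s] ^+ 'C(n, 2).
Proof.
elim: n => [|n IH]; first by rewrite comm1g comm1g mulg1.
have dcn : der_like (c ^ (x ^+ n)) by rewrite conjRg; apply: der_like_comm.
rewrite expgS (commMgJ_group x) (der_like_commM _ dcn); last exact: der_like_comm.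
rewrite -[c ^ _](mulVKg c) -commgEl (der_like_commM (u := c)); first last.
- exact: der_like_comm.
- exact: der_like_comm.
rewrite comm_c_commX IH.
have : forall k l, commute ([~ e1, s] ^+ k) ([~ c, s] ^+ l).
  by move=> k l; apply/commuteX2/comm4_central.
move: ([~ c, s]) ([~ e1, s]) => u v cvu.
rewrite -(mulgA u) (mulgA (v ^+ n)) cvu -(mulgA (u ^+ n)) (mulgA u).
by rewrite -expgS -expgnDr addnC binS bin1.
Qed.

(** Since xy = yx c and c commutes with [c,yx], the commutators [c,xy] and [c,yx] agree; expanding
    both leaves this equality. *)
Lemma comm4_sym : [~ e2, x] = [~ e1, y].
Proof.
have eq_xy : [~ c, x * y] = [~ c, y * x].
  rewrite (commgC x y) (commgMJ_group c (y * x)) commgg mul1g commute_conj //.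
  by apply/(der_like_comm x y).1/second_centre_comm3.
have ce : commute e2 e1 by apply/(der_like_comm c x).1/second_centre_comm3.
have conjE (u v : H) : u ^ v = u * [~ u, v] by rewrite commgEl mulVKg.
move: eq_xy; rewrite (commgMJ_group c x) (commgMJ_group c y) !conjE.
rewrite (mulgA e2 e1) (mulgA e1 e2) ce.
by move/mulgI.
Qed.

(** For w = x^n c^l the four identities say in turn that [w,y,x], [w,y,y], [w,x,x] and [w,x,y] are
    trivial. *)
Lemma cover_pow_eq1 n l :
  pi x ^+ n * [~ pi x, pi y] ^+ l = 1 <->
  [/\ e1 ^+ n * [~ e1, x] ^+ 'C(n, 2) * [~ e1, y] ^+ l = 1,
      e2 ^+ n * [~ e1, y] ^+ 'C(n, 2) * [~ e2, y] ^+ l = 1,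
      [~ e1, x] ^+ l = 1 & [~ e1, y] ^+ l = 1].
Proof.
rewrite -coverR -!coverX -piM pi1; set w := _ * _.
have wx s : [~ [~ w, x], s] = [~ e1, s] ^+ l.
  rewrite /w (commMgJ_group (x ^+ n)) (_ : [~ x ^+ n, x] = 1) ?conj1g ?mul1g.
    rewrite (der_like_commX _ _ (der_like_comm x y)).
    by rewrite (der_like_commX _ _ (der_like_comm c x)).
  by apply/eqP/commgP/commute_sym/commuteX/commute_refl.
have wy s : [~ [~ w, y], s] =
    [~ c, s] ^+ n * [~ e1, s] ^+ 'C(n, 2) * [~ e2, s] ^+ l.
  rewrite /w (commMgJ_group (x ^+ n)) commute_conj; last first.
    exact/commuteX/commute_sym/commute_comm_c.
  rewrite (der_like_commX _ _ (der_like_comm x y)).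
  rewrite der_like_commM; first last.
  - exact/der_likeX/der_like_comm.
  - exact: der_like_comm.
  by rewrite comm_powX (der_like_commX _ _ (der_like_comm c y)).
split=> [Zw | [eqx eqy Al Bl]].
  split; [have := Zw y x | have := Zw y y | have := Zw x x | have := Zw x y];
    by rewrite ?wx ?wy ?comm4_sym.
by apply: second_centre_test; rewrite ?wx ?wy ?comm4_sym.
Qed.

End Criterion.

(* With x, y in H above a, b and c = [x, y], the witnesses are e1 = [c, x],    *)
(* e2 = [c, y], A = [c, x, x], B = [c, x, y] = [c, y, x] and D = [c, y, y].    *)
Lemma capable2_criterion (gT : finGroupType) (G : {group gT}) (a b : gT) :
    capable 2 (subg_of G) -> G :=: <[a]> <*> <[b]> ->
    commute [~ a, b] a -> commute [~ a, b] b ->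
  exists (H : groupType) (e1 e2 A B D : H),
    [/\ [/\ forall h, commute A h, forall h, commute B h
          & forall h, commute D h],
      forall n l, a ^+ n * [~ a, b] ^+ l = 1 <->
        [/\ e1 ^+ n * A ^+ 'C(n, 2) * B ^+ l = 1,
            e2 ^+ n * B ^+ 'C(n, 2) * D ^+ l = 1,
            A ^+ l = 1 & B ^+ l = 1]
    & forall n l, b ^+ n = [~ a, b] ^+ l <->
        [/\ e2 ^+ n * D ^+ 'C(n, 2) * B ^+ l = 1,
            e1 ^+ n * B ^+ 'C(n, 2) * A ^+ l = 1,
            D ^+ l = 1 & B ^+ l = 1]].
Proof.
case/capable2_cover=> H [pi [piM piG piS pi1]] defG cca ccb.
have [[Ga Gb] _] := mem_gen2 defG.
have [[x def_a] [y def_b]] := (piS a Ga, piS b Gb).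
subst a b; have defG' := defG; rewrite joingC in defG'.
have cca' : commute [~ pi y, pi x] (pi y).
  by rewrite -invgR; apply/commute_sym/commuteV/commute_sym.
have ccb' : commute [~ pi y, pi x] (pi x).
  by rewrite -invgR; apply/commute_sym/commuteV/commute_sym.
have crit := cover_pow_eq1 piM piG pi1 defG cca ccb.
have crit' := cover_pow_eq1 piM piG pi1 defG' cca' ccb'.
have comm4 := comm4_central piM piG pi1 defG cca ccb.
have dl := der_like_comm piM piG pi1 defG cca ccb.
pose c := [~ x, y].
exists H, [~ c, x], [~ c, y], [~ c, x, x], [~ c, x, y], [~ c, y, y].
split=> //.
  by split=> *; apply: comm4.
move=> n l; have yx_s s : [~ y, x, s] = [~ c, s]^-1.
  by rewrite -(invgR x) (der_like_commV _ (dl x y)).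
have yx_st s t : [~ y, x, s, t] = [~ c, s, t]^-1.
  by rewrite yx_s (der_like_commV _ (dl c s)).
have prodV (e u v : H) : (forall h, commute u h) -> (forall h, commute v h) ->
    e^-1 * u^-1 * v^-1 = 1 <-> e * u * v = 1.
  move=> cu cv; rewrite -!invgM (cu e) (cv (e * u)).
  by split=> [/(congr1 (fun h => h^-1)) | ->]; rewrite ?invgK invg1.
have cX := fun k s t h => commute_sym (commuteX k (commute_sym (comm4 x y s t h))).
(* The relation for b is the one for a with x and y exchanged; this inverts c, hence every
   witness. *)
transitivity (pi y ^+ n * [~ pi y, pi x] ^+ l = 1).
  rewrite -(invgR (pi x)) expVgn; split=> [-> | /divg1_eq //].
  exact: mulgV.
rewrite crit' !yx_st !yx_s (comm4_sym piM piG pi1 defG cca ccb) !expVgn.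
have V1 (u : H) : u^-1 = 1 <-> u = 1.
  by split=> [/(congr1 (fun h => h^-1)) | ->]; rewrite ?invgK invg1.
have pr1 := prodV _ _ _ (cX 'C(n, 2) y y) (cX l x y).
have pr2 := prodV _ _ _ (cX 'C(n, 2) x y) (cX l x x).
by split=> -[/pr1 ? /pr2 ? /V1 ? /V1 ?].
Qed.

(** Lifts a basis of G/G', with [a] over the larger cyclic factor. The lifts generate G because G'
    lies in the Frattini subgroup. *)
Lemma class2_basis p (gT : finGroupType) (G : {group gT}) :
    prime p -> p.-group G -> (exists a b : gT, G :=: <<[set a; b]>>) ->
    nil_class G = 2 ->
  exists (a b : gT) (al be ga : nat),
    [/\ G :=: <[a]> <*> <[b]>,
        commute [~ a, b] a /\ commute [~ a, b] b,
        0 < ga /\ be <= al,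
        [/\ a ^+ (p ^ al) \in <[[~ a, b]]>, b ^+ (p ^ be) \in <[[~ a, b]]>,
            #[[~ a, b]] = (p ^ ga)%N & #|G| = (p ^ al * p ^ be * p ^ ga)%N]
      & forall i, a ^+ i \in <[[~ a, b]]> -> p ^ al %| i].
Proof.
move=> p_pr pG [a0 [b0 defG0]] clG; pose Q := (G / G^`(1))%G.
have nilG := pgroup_nil pG.
have ncycG : ~~ cyclic G.
  apply: contra_eqN clG => /cyclic_abelian; rewrite -nil_class1.
  by case: (nil_class G) => [|[|]].
have sG'Z : G^`(1) \subset 'Z(G) by rewrite -nil_class2 clG.
have abQ : abelian Q by apply: der_abelian.
have pQ : p.-group Q by apply: quotient_pgroup.
have [s defQ ords] := abelian_structure abQ.
have size_s : size s <= 2.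
  rewrite -(size_map order) ords size_abelian_type // -grank_abelian //.
  apply: leq_trans (quotient_grank (der_norm 1 G)) _.
  by rewrite defG0 (leq_trans (grank_min _)) // cards2; case: eqP.
have ncycQ : ~~ cyclic Q by apply: contra ncycG; apply: cyclic_nilpotent_quo_der1_cyclic.
case: s size_s defQ ords => [|x [|y []]] // _.
- by rewrite big_nil => defQ; rewrite -defQ cyclic1 in ncycQ.
- by rewrite big_seq1 => defQ; rewrite /= -defQ cycle_cyclic in ncycQ.
rewrite big_cons big_seq1 /= => defQ ords.
have [_ defQm cxy tixy] := dprodP defQ.
have ord_yx : #[y] %| #[x].
  by have := abelian_type_dvdn_sorted Q; rewrite -ords /= andbT.
have Qx : x \in G / G^`(1).
  by rewrite -defQm (subsetP (mulG_subl _ _)) ?cycle_id.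
have Qy : y \in G / G^`(1).
  by rewrite -defQm (subsetP (mulG_subr _ _)) ?cycle_id.
have [al ox] := p_natP (mem_p_elt pQ Qx : p.-nat #[x]).
have [be oy] := p_natP (mem_p_elt pQ Qy : p.-nat #[y]).
have [a Na Ga def_x] := morphimP Qx; have [b Nb Gb def_y] := morphimP Qy.
have Gc : [~ a, b] \in G^`(1) by rewrite mem_commg.
have /centerP[_ cc] := subsetP sG'Z _ Gc.
have cca := cc a Ga; have ccb := cc b Gb.
have defG : G :=: <[a]> <*> <[b]>.
  have -> : <[a]> <*> <[b]> = <<[set a; b]>> by rewrite joing_idl joing_idr.
  apply/esym/Phi_nongen/eqP; rewrite eqEsubset join_subG Phi_sub subUset !sub1set.
  rewrite Ga Gb /=; apply: (@subset_trans _ _ (mem (G^`(1) * <<[set a; b]>>))).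
    rewrite -quotientSK ?der_norm // -defQm mul_subG // cycle_subG.
      by rewrite def_x mem_quotient ?mem_gen ?set21.
    by rewrite def_y mem_quotient ?mem_gen ?set22.
  rewrite -['Phi(G) <*> _]joing_idr mul_subG ?joing_subr //.
  by rewrite (subset_trans _ (joing_subl _ _)) // (Phi_joing pG) joing_subl.
have defG' := der1_gen2 defG cca ccb.
have Gc' := subsetP (der_sub 1 G) _ Gc.
have [ga oc] := p_natP (mem_p_elt pG Gc' : p.-nat #[[~ a, b]]).
have xyE i j : (x ^+ i * y ^+ j == 1) = (a ^+ i * b ^+ j \in <[[~ a, b]]>).
  by rewrite def_x def_y (coset_der1E defG cca ccb).
exists a, b, al, be, ga; split=> //.
- split; last by move: ord_yx; rewrite ox oy dvdn_Pexp2l ?prime_gt1.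
  rewrite lt0n; apply: contra_eqN clG => /eqP ga0.
  have : abelian G.
    by apply/derG1P; rewrite defG'; apply/trivgP; rewrite cycle_subG inE
      -order_eq1 oc ga0.
  by rewrite -nil_class1; case: (nil_class G) => [|[|]].
- split=> //.
  + by have := xyE (p ^ al)%N 0; rewrite !mulg1 -ox expg_order eqxx => <-.
  + by have := xyE 0 (p ^ be)%N; rewrite !mul1g -oy expg_order eqxx => <-.
  rewrite -(Lagrange (der_sub 1 G)) -card_quotient ?der_norm // -/Q.
  have oG' : #|G^`(1)| = (p ^ ga)%N by rewrite defG' -orderE oc.
  by rewrite -(dprod_card defQ) -!orderE ox oy /= oG' mulnC.
move=> i aic; rewrite -ox order_dvdn; apply/eqP.
by have := xyE i 0; rewrite !mulg1 aic => /eqP.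
Qed.

(** * Binomial coefficients modulo prime powers, and changes of generators *)

Lemma dvdn_bin2_odd p g t : odd p -> g <= t -> p ^ g %| 'C(p ^ t, 2).
Proof.
move=> p_odd le_gt; rewrite bin2odd ?oddX ?p_odd ?orbT //.
exact/dvdn_mulr/dvdn_exp2l.
Qed.

Lemma bin2_pow2 t : 'C(2 ^ t.+1, 2) = (2 ^ t * (2 ^ t.+1).-1)%N.
Proof. by rewrite bin2 {1}expnS -mulnA mul2n doubleK. Qed.

Lemma dvdn_bin2_prime p g t : prime p -> g <= t -> odd p \/ g < t ->
  p ^ g %| 'C(p ^ t, 2).
Proof.
move=> p_pr le_gt; have [p_odd _|] := boolP (odd p).
  exact: dvdn_bin2_odd.
case/(prime_oddPn p_pr)=> -> [//|].
by case: t {le_gt} => // t lt_gt; rewrite bin2_pow2 dvdn_mulr // dvdn_exp2l.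
Qed.

Lemma pow2_half g x : 0 < g -> 2 ^ g %| x * 2 -> ~~ (2 ^ g %| x) ->
  exists t, x = (2 ^ g * t + 2 ^ g.-1)%N.
Proof.
case: g => // g _ /=; rewrite {1}expnSr dvdn_pmul2r // => /dvdnP[y ->].
rewrite expnS dvdn_pmul2r ?expn_gt0 // dvdn2 negbK => y_odd; exists y./2.
by rewrite -{1}(odd_double_half y) y_odd -muln2; nia.
Qed.

(** The obstruction peculiar to p = 2: C(2^g,2) is congruent to 2^(g-1), not 0, modulo 2^g. *)
Lemma bin2_pow2_half g : 0 < g ->
  exists t, 'C(2 ^ g, 2) = (2 ^ g * t + 2 ^ g.-1)%N.
Proof.
move=> g_gt0; apply: pow2_half => //; case: g g_gt0 => // g _.
  by rewrite bin2_pow2 mulnAC -expnSr dvdn_mulr.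
rewrite bin2_pow2 expnSr dvdn_pmul2l ?expn_gt0 // dvdn2 negbK.
by rewrite -subn1 oddB ?oddM ?andbF // muln_gt0 expn_gt0.
Qed.

Lemma mem_joing_cycles (gT : finGroupType) (u v : gT) :
  u \in <[u]> <*> <[v]> /\ v \in <[u]> <*> <[v]>.
Proof. by split; rewrite mem_gen // inE cycle_id ?orbT. Qed.

Lemma joingMr (gT : finGroupType) (a b : gT) :
  <[b * a]> <*> <[a]> = <[b]> <*> <[a]>.
Proof.
have [[Kb Ka] [Lba La]] := (mem_joing_cycles b a, mem_joing_cycles (b * a) a).
apply/eqP; rewrite eqEsubset !join_subG !cycle_subG Ka La groupM //= andbT.
by rewrite -(groupMr _ La).
Qed.

Lemma joingMl (gT : finGroupType) (a b : gT) :
  <[b * a]> <*> <[b]> = <[a]> <*> <[b]>.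
Proof.
have [[Ka Kb] [Lba Lb]] := (mem_joing_cycles a b, mem_joing_cycles (b * a) b).
apply/eqP; rewrite eqEsubset !join_subG !cycle_subG Kb Lb groupM //= andbT.
by rewrite -(groupMl _ Lb).
Qed.

(** * Arithmetic of the relations in a 2-capable group *)

Section CapableRelations.

Variables (p : nat) (gT : finGroupType) (G : {group gT}) (a b : gT).
Variables (al be ga k l : nat).
Local Notation c := [~ a, b].
Local Notation m := (p ^ al)%N.
Local Notation n := (p ^ be)%N.
Local Notation q := (p ^ ga)%N.
Hypothesis p_prime : prime p.
Hypothesis defG : G :=: <[a]> <*> <[b]>.
Hypotheses (cca : commute c a) (ccb : commute c b).
Hypotheses (ga_gt0 : 0 < ga) (ga_be : ga <= be) (be_al : be <= al).
Hypotheses (oc : #[c] = q) (am : a ^+ m * c ^+ l = 1) (bn : b ^+ n = c ^+ k).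
Hypothesis oam : forall i, a ^+ i \in <[c]> -> m %| i.

Variables (H : groupType) (e1 e2 A B D : H).
Hypotheses (cA : forall h, commute A h).
Hypotheses (cB : forall h, commute B h) (cD : forall h, commute D h).
Hypothesis crita : forall n l, a ^+ n * c ^+ l = 1 <->
        [/\ e1 ^+ n * A ^+ 'C(n, 2) * B ^+ l = 1,
            e2 ^+ n * B ^+ 'C(n, 2) * D ^+ l = 1,
            A ^+ l = 1 & B ^+ l = 1].
Hypothesis critb : forall n l, b ^+ n = c ^+ l <->
        [/\ e2 ^+ n * D ^+ 'C(n, 2) * B ^+ l = 1,
            e1 ^+ n * B ^+ 'C(n, 2) * A ^+ l = 1,
            D ^+ l = 1 & B ^+ l = 1].

(** [crita] for n = 0: the order of c is read off from A, B and D together. *)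
Lemma crit_c j : q %| j <-> [/\ A ^+ j = 1, B ^+ j = 1 & D ^+ j = 1].
Proof.
rewrite -oc order_dvdn; have := crita 0 j; rewrite !bin0n /= !mul1g => critj.
by split=> [/eqP/critj[] | [Aj Bj Dj]] //; apply/eqP/critj.
Qed.

Lemma killA j : q %| j -> A ^+ j = 1. Proof. by case/crit_c. Qed.
Lemma killB j : q %| j -> B ^+ j = 1. Proof. by case/crit_c. Qed.
Lemma killD j : q %| j -> D ^+ j = 1. Proof. by case/crit_c. Qed.

Lemma crit_rels :
  [/\ A ^+ l = 1, B ^+ l = 1, B ^+ k = 1 & D ^+ k = 1] /\
  [/\ e1 ^+ m * A ^+ 'C(m, 2) = 1, e2 ^+ m * B ^+ 'C(m, 2) * D ^+ l = 1,
      e2 ^+ n * D ^+ 'C(n, 2) = 1 & e1 ^+ n * B ^+ 'C(n, 2) * A ^+ k = 1].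
Proof.
have [E1 E2 Al Bl] := (crita m l).1 am.
have [F1 F2 Dk Bk] := (critb n k).1 bn.
by move: E1 F1; rewrite Bl Bk !mulg1.
Qed.

Lemma centralX (z h : H) i :
  (forall h, commute z h) -> commute h (z ^+ i).
Proof. by move=> cz; apply/commuteX/commute_sym. Qed.

(* Raising the relations to the power r kills their binomial corrections; r is *)
(* 1, or 2 when p = 2 and beta = gamma.                                        *)
Lemma capable_valuation r :
    n * r %| m -> q %| 'C(n, 2) * r -> q %| 'C(m, 2) ->
  [/\ a ^+ m = 1, q %| k * p ^ (al - be)
    & be < al -> n * r %| p ^ al.-1 -> q %| 'C(p ^ al.-1, 2) ->
      ~~ (q %| k * p ^ (al - be).-1)].
Proof.
move=> nr_m q_Cnr q_Cm.
have [[Al Bl Bk Dk] [E1 E2 F1 F2]] := crit_rels.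
have {}F1 : e2 ^+ (n * r) = 1.
  have := congr1 (fun h => h ^+ r) F1; rewrite expgMn; last exact: centralX.
  by rewrite expg1n -!expgnA (killD q_Cnr) mulg1.
have {}F2 t : e1 ^+ (n * r * t) = 1 <-> A ^+ (k * (r * t)) = 1.
  have Brt : B ^+ ('C(n, 2) * (r * t)) = 1 by rewrite mulnA; exact/killB/dvdn_mulr.
  have := congr1 (fun h => h ^+ (r * t)) F2.
  rewrite expgMn; last exact: centralX.
  rewrite expgMn; last exact: centralX.
  rewrite expg1n -!expgnA Brt mulg1 mulnA => eA.
  by split=> E; move: eA; rewrite E ?mul1g ?mulg1.
(* As n r divides m, e2^m is trivial, so the identity [E2] reduces to D^l = 1. With A^l = B^l = 1
   this gives c^l = 1. *)
have Dl : D ^+ l = 1.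
  move: E2; rewrite (killB q_Cm) mulg1.
  by rewrite -(divnK nr_m) mulnC expgnA F1 expg1n mul1g.
have cl : c ^+ l = 1 by apply/eqP; rewrite -order_dvdn oc; apply/crit_c.
have m_nr : (m = n * r * (m %/ (n * r)))%N by rewrite mulnC divnK.
have n_gt0 : 0 < n by rewrite expn_gt0 prime_gt0.
have expE t : n * r %| p ^ t -> (r * (p ^ t %/ (n * r)) = p ^ (t - be))%N.
  move=> nr_t; have lt_bt : be <= t.
    by rewrite -(@dvdn_Pexp2l p) ?prime_gt1 // (dvdn_trans _ nr_t) ?dvdn_mulr.
  apply/eqP; rewrite -(eqn_pmul2l n_gt0) mulnA [(_ * (_ %/ _))%N]mulnC divnK //.
  by rewrite -expnD subnKC.
have kE t : q %| k * t <-> A ^+ (k * t) = 1.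
  split=> [/killA // | At]; apply/crit_c; split=> //.
    by rewrite expgnA Bk expg1n.
  by rewrite expgnA Dk expg1n.
split; first by move: am; rewrite cl mulg1.
  apply/kE; rewrite -(expE _ nr_m); apply/F2; rewrite -m_nr.
  by move: E1; rewrite (killA q_Cm) mulg1.
move=> lt_ba nr_m' q_Cm'.
have m'E : (p ^ al.-1 = n * r * (p ^ al.-1 %/ (n * r)))%N by rewrite mulnC divnK.
(* Were q to divide this product, e1 and e2 would have trivial (m/p)-th powers, so a^(m/p) = 1,
   against [oam]. *)
apply/negP => /kE; rewrite predn_sub.
rewrite -(expE _ nr_m') => /F2; rewrite -m'E => e1m'.
have e2m' : e2 ^+ (p ^ al.-1) = 1 by rewrite m'E expgnA F1 expg1n.
have : a ^+ (p ^ al.-1) * c ^+ 0 = 1.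
  by apply/crita; rewrite e1m' e2m' (killA q_Cm') (killB q_Cm') !mulg1.
rewrite mulg1 => am'; have := @oam (p ^ al.-1).
rewrite am' group1 => /(_ isT); rewrite dvdn_Pexp2l ?prime_gt1 // leqNgt.
by move: lt_ba; clear; case: al => //= t _; rewrite leqnn.
Qed.

(** For be < al the divisibilities say k = u p^si with u prime to p. Replacing a by a^u turns c into
    c^u and absorbs u. For be = al they give b^n = 1. *)
Lemma pres_valuation si : si <= ga ->
    a ^+ m = 1 -> si + (al - be) = ga ->
    q %| k * p ^ (al - be) -> (be < al -> ~~ (q %| k * p ^ (al - be).-1)) ->
  pres m n q (p ^ si) G.
Proof.
move=> si_ga am1 si_eq q_k q_nk.
have [lt_ba|le_ab] := ltnP be al; last first.
  have al_be : (al - be = 0)%N by apply/eqP; rewrite subn_eq0.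
  exists a, b; split; rewrite -?oc ?expg_order //.
  have -> : si = ga by move: si_eq; rewrite al_be addn0.
  rewrite bn -oc expg_order; apply/eqP; rewrite -order_dvdn oc.
  by move: q_k; rewrite al_be muln1.
have p_gt0 := prime_gt0 p_prime.
have k_gt0 : 0 < k.
  by rewrite lt0n; apply: contraNneq (q_nk lt_ba) => ->; rewrite mul0n.
have [u cop_pu k_eq] := pfactor_coprime p_prime k_gt0.
move: (logn p k) k_eq => v k_eq.
have cop_u t : coprime (p ^ t) u by apply: coprimeXl.
have v_si : v = si.
  have := q_nk lt_ba; move: q_k; rewrite k_eq -!mulnA -!expnD.
  rewrite !Gauss_dvdr ?cop_u // !dvdn_Pexp2l ?prime_gt1 //.
  by move: si_eq lt_ba; clear; lia.
have cau : [~ a ^+ u, b] = c ^+ u.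
  have := @commXXg _ u 1 a b (commute_sym cca) (commute_sym ccb).
  by rewrite muln1 expg1.
have gen_a : <[a ^+ u]> = <[a]>.
  apply/esym/eqP; rewrite -[_ == _]/(generator _ _) generator_coprime.
  apply: (@coprime_dvdl _ m); last exact: cop_u.
  by rewrite order_dvdn am1.
exists (a ^+ u), b; rewrite /pres_gens cau; split.
- by rewrite gen_a.
- by rewrite expgnAC am1 expg1n.
- by rewrite bn k_eq v_si expgnA.
- by rewrite expgnAC -oc expg_order expg1n.
split; last exact/commute_sym/commuteX/commute_sym.
by apply: commuteX2.
Qed.

(** Comparing the identities shows that q divides 2k and 2l, so k and l are 0 or h = q/2 modulo q.
    If just one of them is h, replacing the other generator's partner by b a repairs it: (b a)^q =
    b^q a^q c^h. *)
Lemma capable_even_balanced : p = 2 -> al = ga -> be = ga -> pres q q q q G.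
Proof.
move=> p2 eq_al eq_be; have [[Al Bl Bk Dk] [E1 E2 F1 F2]] := crit_rels.
move: am bn E1 E2 F1 F2; rewrite eq_al eq_be => aq bq E1 E2 F1 F2.
have [t Cq] : exists t, 'C(q, 2) = (q * t + p ^ ga.-1)%N.
  by rewrite p2; apply: bin2_pow2_half.
have powE (K : groupType) (z : K) s : z ^+ q = 1 ->
    z ^+ (q * s + p ^ ga.-1) = z ^+ (p ^ ga.-1).
  by move=> zq; rewrite expgnDr expgnA zq expg1n mul1g.
have Aq := killA (dvdnn q); have Bq := killB (dvdnn q).
have Dq := killD (dvdnn q); have cq : c ^+ q = 1 by rewrite -oc expg_order.
have h2 : q %| p ^ ga.-1 * 2 by rewrite -p2 -expnSr prednK.
move: E1 E2 F1 F2; rewrite Cq !powE //.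
set h := (p ^ ga.-1)%N in h2 Cq powE *; move=> E1 E2 F1 F2.
have eqA : A ^+ h = B ^+ h * A ^+ k.
  by apply: (mulgI (e1 ^+ q)); rewrite mulgA E1 F2.
have eqD : D ^+ h = B ^+ h * D ^+ l.
  by apply: (mulgI (e2 ^+ q)); rewrite mulgA E2 F1.
have Ak2 : A ^+ (k * 2) = 1.
  have := congr1 (fun z => z ^+ 2) eqA; rewrite expgMn; last exact: centralX.
  by rewrite -!expgnA (killA h2) (killB h2) mul1g.
have Dl2 : D ^+ (l * 2) = 1.
  have := congr1 (fun z => z ^+ 2) eqD; rewrite expgMn; last exact: centralX.
  by rewrite -!expgnA (killD h2) (killB h2) mul1g.
have k2 : q %| k * 2 by apply/crit_c; rewrite Ak2 !expgnA Bk Dk !expg1n.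
have l2 : q %| l * 2 by apply/crit_c; rewrite Dl2 !expgnA Bl Al !expg1n.
have half x : q %| x * 2 -> ~~ (q %| x) -> exists t, x = (q * t + h)%N.
  by rewrite /h p2; apply: pow2_half.
have cX x : q %| x -> c ^+ x = 1 by rewrite -oc order_dvdn => /eqP.
have baq : (b * a) ^+ q = b ^+ q * a ^+ q * c ^+ h.
  by rewrite expMg_Rmul ?Cq ?powE //; apply: commute_sym.
have chh : c ^+ h * c ^+ h = 1 by rewrite -expgnDr addnn -muln2 cX.
have [[Ga Gb] Gc] := mem_gen2 defG.
have [q_k|] := boolP (q %| k); have [q_l|] := boolP (q %| l).
- exists a, b; split; rewrite ?cq // ?bq ?cX //.
  by move: aq; rewrite cX ?mulg1.
- case/(half _ l2)=> t' l_eq; have ah : a ^+ q = c ^+ h.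
    by apply: (mulIg (c ^+ h)); rewrite chh -aq l_eq powE.
  have cba : [~ b * a, b] = c by rewrite commMgJ commgg conj1g mul1g.
  exists (b * a), b; rewrite /pres_gens cba; split.
  + by rewrite defG joingMl.
  + by rewrite baq bq cX // mul1g ah.
  + by rewrite bq cq cX.
  + by [].
  by split=> //; apply: commuteM.
- case/(half _ k2)=> t' k_eq; have bh : b ^+ q = c ^+ h by rewrite bq k_eq powE.
  have cba : [~ a, b * a] = c.
    by rewrite commgMJ_group commgg mul1g commute_conj.
  have aq1 : a ^+ q = 1 by move: aq; rewrite cX ?mulg1.
  exists a, (b * a); rewrite /pres_gens cba; split=> //.
  + by rewrite defG joingC (joingC <[a]>) joingMr.
  + by rewrite baq aq1 bh mulg1 chh cq.
  by split=> //; apply: commuteM.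
(* If both are h, then A, B and D all have trivial h-th power, so q would divide q/2. *)
move=> /(half _ l2)[t1 l_eq] /(half _ k2)[t2 k_eq].
have : q %| h.
  by apply/crit_c; move: Al Bl Dk; rewrite l_eq k_eq !powE.
rewrite dvdn_Pexp2l ?prime_gt1 //.
by move: ga_gt0; clear; case: ga => // g _; rewrite ltnn.
Qed.

(** Otherwise k is q/2 modulo q, which is also the value of C(q,2); the identities for b^q then
    become those for a^q = 1, contradicting m = 2q. *)
Lemma capable_even_near : p = 2 -> al = be.+1 -> be = ga ->
  a ^+ m = 1 -> q %| k * 2 -> pres m n q q G.
Proof.
move=> p2 eq_al eq_be am1 k2.
have cq : c ^+ q = 1 by rewrite -oc expg_order.
have [q_k | nq_k] := boolP (q %| k).
  exists a, b; split; rewrite ?cq // bn.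
  by apply/eqP; rewrite -order_dvdn oc.
have [[Al Bl Bk Dk] [E1 E2 F1 F2]] := crit_rels.
have [t Cq] : exists t, 'C(q, 2) = (q * t + p ^ ga.-1)%N.
  by rewrite p2; apply: bin2_pow2_half.
have [t' k_eq] : exists t, k = (q * t + p ^ ga.-1)%N.
  by move: k2 nq_k; rewrite p2; apply: pow2_half.
have powE (z : H) s : z ^+ q = 1 ->
    z ^+ (q * s + p ^ ga.-1) = z ^+ (p ^ ga.-1).
  by move=> zq; rewrite expgnDr expgnA zq expg1n mul1g.
have Aq := killA (dvdnn q); have Bq := killB (dvdnn q).
have Dq := killD (dvdnn q).
move: F1 F2 Bk Dk; rewrite eq_be Cq k_eq !powE // => F1 F2 Bh Dh.
move: F1 F2; rewrite Bh Dh !mulg1 => F1 F2.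
have aq : a ^+ q * c ^+ 0 = 1.
  by apply/crita; rewrite Cq !powE // F1 F2 Bh !mulg1.
have := @oam q; move: aq; rewrite mulg1 => ->; rewrite group1 => /(_ isT).
rewrite eq_al eq_be dvdn_Pexp2l ?prime_gt1 //.
by rewrite ltnn.
Qed.

End CapableRelations.

(** If p is odd or gamma < beta, [capable_valuation] applies with r = 1. For p = 2 and beta = gamma
    it applies fully with r = 2 once alpha is at least beta + 2; the two smaller values of alpha are
    treated apart. *)
Lemma capable_pres p (gT : finGroupType) (G : {group gT}) :
    prime p -> p.-group G -> (exists a b : gT, G :=: <<[set a; b]>>) ->
    nil_class G = 2 -> capable 2 (subg_of G) ->
  exists al be ga si,
    [/\ (0 < ga) && (ga <= be <= al), presents_exponents p (al, be, ga, si) G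
      & (si + (al - be) = ga)%N /\ (odd p \/ ~~ ((al == be.+1) && (be == ga)))
        \/ [/\ p = 2, al = be.+1, be = ga & si = ga]].
Proof.
move=> p_pr pG gens clG capG.
have [a [b [al [be [ga [defG [cca ccb] [ga_gt0 be_al] [am bn oc oG] oam]]]]]] :=
  class2_basis p_pr pG gens clG.
(* c^n = [a,b^n] is trivial because b^n is a power of c. *)
have ga_be : ga <= be.
  rewrite -(@dvdn_Pexp2l p) ?prime_gt1 // -oc order_dvdn.
  have := @commXXg _ 1 (p ^ be) a b (commute_sym cca) (commute_sym ccb).
  rewrite mul1n expg1 => <-; apply/eqP/eqP/commgP.
  by case/cycleP: bn => j ->; apply/commuteX/commute_sym.
have [l am1] : exists l, a ^+ (p ^ al) * [~ a, b] ^+ l = 1.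
  have : (a ^+ (p ^ al))^-1 \in <[[~ a, b]]> by rewrite groupV.
  by case/cycleP=> l eq_l; exists l; rewrite -eq_l mulgV.
case/cycleP: bn => k bn.
have [H [e1 [e2 [A [B [D [[cA cB cD] crita critb]]]]]]] :=
  capable2_criterion capG defG cca ccb.
have val r := capable_valuation (r := r) p_pr oc am1 bn oam cA cB cD crita critb.
have presV si := pres_valuation (si := si) p_pr defG cca ccb oc bn.
have expP_gt0 i : 0 < p ^ i by rewrite expn_gt0 prime_gt0.
have isoG si : pres (p ^ al) (p ^ be) (p ^ ga) (p ^ si) G ->
    presents_exponents p (al, be, ga, si) G.
  by move=> presG; apply: presents_card.
have sg_range : (0 < ga) && (ga <= be <= al) by rewrite ga_gt0 ga_be.
have p2 : ~~ odd p -> p = 2 by move/(prime_oddPn p_pr).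
have dvdC := dvdn_bin2_prime p_pr.
have finish r : p ^ be * r %| p ^ al -> p ^ ga %| 'C(p ^ be, 2) * r ->
    p ^ ga %| 'C(p ^ al, 2) ->
    (be < al -> p ^ be * r %| p ^ al.-1 /\ p ^ ga %| 'C(p ^ al.-1, 2)) ->
  exists si, si + (al - be) = ga /\ presents_exponents p (al, be, ga, si) G.
  move=> h1 h2 h3 h4; have [am' q_k q_nk] := val r h1 h2 h3.
  have {}q_nk: be < al -> ~~ (p ^ ga %| k * p ^ (al - be).-1).
    by move=> lt_ba; have [? ?] := h4 lt_ba; apply: q_nk.
  have le_d : al - be <= ga.
    have [lt_ba | le_ab] := ltnP be al; last by rewrite (eqP le_ab).
    rewrite leqNgt; apply: contra (q_nk lt_ba) => lt_ga.
    by rewrite dvdn_mull // dvdn_exp2l //; move: lt_ga; clear; lia.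
  exists (ga - (al - be)); split; first exact: subnK.
  by apply: isoG; apply: presV (subnK le_d) q_k q_nk => //; apply: leq_subr.
have [easy | hard] := boolP (odd p || (ga < be)).
  have easyP t : ga <= t -> be <= t -> p ^ ga %| 'C(p ^ t, 2).
    move=> le_gt le_bt; apply: dvdC => //; case/orP: easy => [|lt_gb]; first by left.
    by right; apply: leq_trans le_bt.
  have [||||si [si_eq presG]] := finish 1%N.
  - by rewrite muln1 dvdn_exp2l.
  - by rewrite muln1 easyP.
  - by rewrite easyP // (leq_trans ga_be).
  - move=> lt_ba; have le' : be <= al.-1 by move: lt_ba; clear; lia.
    by rewrite muln1 dvdn_exp2l // easyP // (leq_trans ga_be).
  exists al, be, ga, si; split=> //; left; split=> //.
  case/orP: easy => [|lt_gb]; [by left | right].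
  by rewrite negb_and orbC (gtn_eqF lt_gb).
move: hard; rewrite negb_or -leqNgt => /andP[/p2 p_2 be_ga].
have {be_ga}ga_eq : be = ga by apply/eqP; rewrite eqn_leq be_ga.
have dvdC' t : ga < t -> p ^ ga %| 'C(p ^ t, 2).
  by move=> lt_gt; apply: dvdC; [apply: ltnW | right].
have C2 : p ^ ga %| 'C(p ^ be, 2) * 2.
  rewrite ga_eq p_2; case: (ga) ga_gt0 => // g _.
  by rewrite bin2_pow2 mulnAC -expnSr dvdn_mulr.
have n2 t : ga < t -> p ^ be * 2 %| p ^ t.
  by move=> lt_gt; rewrite ga_eq -p_2 -expnSr dvdn_exp2l.
have [lt_ba | le_ab] := ltnP be al; last first.
  have al_eq : al = ga by apply/eqP; rewrite -ga_eq eqn_leq le_ab.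
  exists al, be, ga, ga; split=> //.
    apply: isoG; rewrite al_eq ga_eq.
    exact: (capable_even_balanced p_pr defG cca ccb ga_gt0 oc am1 bn cA cD crita critb).
  left; split; first by rewrite al_eq ga_eq subnn addn0.
  by right; rewrite al_eq ga_eq; move: ga_gt0; clear; lia.
have lt_ga : ga < al by rewrite -ga_eq.
have [al_eq | al_neq] := eqVneq al be.+1.
  have [am' q_k _] := val 2 (n2 _ lt_ga) C2 (dvdC' _ lt_ga).
  exists al, be, ga, ga; split=> //; last by right.
  apply: isoG.
  apply: (capable_even_near p_pr defG cca ccb ga_gt0 oc am1 bn oam crita critb) => //.
  by move: q_k; rewrite al_eq subSnn expn1 p_2.
have lt_ga' : ga < al.-1 by move: lt_ba al_neq; rewrite ga_eq; clear; lia.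
have [|si [si_eq presG]] := finish 2 (n2 _ lt_ga) C2 (dvdC' _ lt_ga).
  by move=> _; split; [apply: n2 | apply: dvdC'].
by exists al, be, ga, si; split=> //; left; split=> //; right; rewrite negb_and al_neq.
Qed.

Lemma capable_odd_index p (gT : finGroupType) (G : {group gT}) :
    prime p -> odd p -> p.-group G ->
    (exists a b : gT, G :=: <<[set a; b]>>) ->
    nil_class G = 2 -> capable 2 (subg_of G) ->
  exists i, odd_admissible i /\ iso_odd p i G.
Proof.
move=> p_pr p_odd pG gens clG capG.
have [al [be [ga [si [/and3P[ga_gt0 ga_be be_al] presG]]]]] :=
  capable_pres p_pr pG gens clG capG.
case=> [[si_eq _] | [p2]]; last by rewrite p2 in p_odd.
have [lt_ba | le_ab] := ltnP be al.
  exists (I3 al be ga si); split; last exact/iso_oddE.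
  by split=> //; move: si_eq lt_ba; clear; lia.
have eq_ab : be = al by apply/eqP; rewrite eqn_leq be_al.
have eq_si : si = ga by rewrite -si_eq eq_ab subnn addn0.
subst be si; have [lt_ga | le_ag] := ltnP ga al.
  by exists (I2 al ga); split=> //; apply/iso_oddE.
have eq_ga : ga = al by apply/eqP; rewrite eqn_leq ga_be.
subst ga; exists (I1 al); split=> //; exact/iso_oddE.
Qed.

Lemma capable_even_index (gT : finGroupType) (G : {group gT}) :
    2.-group G -> (exists a b : gT, G :=: <<[set a; b]>>) ->
    nil_class G = 2 -> capable 2 (subg_of G) ->
  exists i, even_admissible i /\ iso_even i G.
Proof.
move=> pG gens clG capG.
have [al [be [ga [si [/and3P[ga_gt0 ga_be be_al] presG]]]]] :=
  capable_pres (p := 2) isT pG gens clG capG.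
case=> [[si_eq [//|nnear]] | [_ eq_al eq_be eq_si]]; last first.
  subst al be si; exists (I5 ga); split=> //; exact/iso_evenE.
have [lt_ba | le_ab] := ltnP be al.
  exists (I7 al be ga si); split; last exact/iso_evenE.
  by split=> //; move: si_eq lt_ba nnear; clear; lia.
have eq_ab : be = al by apply/eqP; rewrite eqn_leq be_al.
have eq_si : si = ga by rewrite -si_eq eq_ab subnn addn0.
subst be si; have [lt_ga | le_ag] := ltnP ga al.
  by exists (I6 al ga); split=> //; apply/iso_evenE.
have eq_ga : ga = al by apply/eqP; rewrite eqn_leq ga_be.
subst ga; exists (I4 al); split=> //; exact/iso_evenE.
Qed.

(** * Sufficiency *)

(** The last condition says that the kernel of f is the preimage of Z_2(H/N), so H/N is the required
    group. *)
Lemma capable2_of_cover (gT : finGroupType) (G : {group gT}) (H : groupType)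
    (N : normalSubgroup H) (f : H -> gT) :
    {morph f : x y / x * y} -> (forall x, f x \in G) ->
    (forall g, g \in G -> exists x, f x = g) ->
    (forall x, f x = 1 <-> forall s t, N [~ [~ x, s], t]) ->
  capable 2 (subg_of G).
Proof.
move=> fM fG fS f1; pose cls := \pi_(nsub_quotient N)%qT.
have f_1 : f 1 = 1 by apply: (mulgI (f 1)); rewrite -fM !mulg1.
have fV x : f x^-1 = (f x)^-1.
  by apply: (mulgI (f x)); rewrite -fM !mulgV f_1.
have clsM x y : cls (x * y) = cls x * cls y by rewrite /cls -qmulE.
have clsV x : cls x^-1 = (cls x)^-1 by rewrite /cls -qinvE.
have cls1 x : cls x = 1 <-> N x.
  split=> [/esym/clsE|Nx]; first by rewrite invg1 mul1g.
  by apply/esym/clsE; rewrite invg1 mul1g.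
have clsR x y : cls [~ x, y] = [~ cls x, cls y].
  by rewrite /commg /conjg !clsM !clsV.
have Z2cls x : upper_central 2 (cls x) <-> f x = 1.
  rewrite f1; split=> [Zx s t | Nx].
    by apply/cls1; rewrite !clsR; apply: Zx.
  rewrite /=; elim/quotW=> s; elim/quotW=> t.
  by rewrite -[LHS]/[~ [~ cls x, cls s], cls t] -(clsR x) -clsR; apply/cls1/Nx.
pose Q := nsub_quotient (ucs (nsub_quotient N) 2).
pose cl2 := \pi_Q%qT.
have cl2E x y : cl2 (cls x) = cl2 (cls y) <-> f x = f y.
  rewrite -[cl2 _ = _]/(\pi_Q%qT (cls x) = \pi_Q%qT (cls y)) clsE ucsE.
  rewrite -clsV -clsM Z2cls fM fV; split=> [/mulg1_eq | ->]; last exact: mulVg.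
  by rewrite invgK.
have surj (k : subg_of G) : exists x, f x == sgval k.
  by have [x <-] := fS _ (subgP k); exists x.
pose g k := xchoose (surj k).
have gK k : f (g k) = sgval k by apply/eqP/(xchooseP (surj k)).
have phiM : {morph (fun k => cl2 (cls (g k))) : k1 k2 / k1 * k2}.
  move=> k1 k2; transitivity (cl2 (cls (g k1) * cls (g k2))).
    by rewrite -clsM; apply/cl2E; rewrite fM !gK.
  by rewrite /cl2 -qmulE.
pose phi : {multiplicative subg_of G -> Q} :=
  HB.pack (fun k => cl2 (cls (g k))) (isMultiplicative.Build _ _ _ phiM).
exists (nsub_quotient N), phi.
exists (fun u : Q => subg G (f (repr (repr u)))) => [k | u] /=.
  apply: val_inj; rewrite /= subgK ?fG // -(gK k).
  by apply/cl2E; rewrite /cls /cl2 !reprK.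
rewrite -[RHS]reprK -[repr u in RHS]reprK; apply/cl2E.
by rewrite gK subgK.
Qed.

(** * Integer binomials and the unipotent extension *)

Section IntBinomials.
Import GRing.Theory.
Local Open Scope ring_scope.

(** Binomials at possibly negative arguments, since the exponent of x runs over all integers; the
    divisions are exact. *)
Definition zbin2 (z : int) : int := (z * (z - 1) %/ 2)%Z.
Definition zbin3 (z : int) : int := (z * (z - 1) * (z - 2) %/ 6)%Z.

Arguments zbin2 : simpl never.
Arguments zbin3 : simpl never.

Lemma zbin2E z : zbin2 z * 2 = z * (z - 1).
Proof.
rewrite /zbin2 divzK //; apply/dvdzP.
have [t [-> | ->]] : exists t, z = t * 2 \/ z = t * 2 + 1 :> int.
- by exists (z %/ 2)%Z; lia.
- by exists (t * (t * 2 - 1)); ring.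
by exists ((t * 2 + 1) * t); ring.
Qed.

Lemma zbin3E z : zbin3 z * 6 = z * (z - 1) * (z - 2).
Proof.
rewrite /zbin3 divzK //; apply/dvdzP.
have [t] : exists t, z = t * 6 \/ z = t * 6 + 1 \/ z = t * 6 + 2 \/
    z = t * 6 + 3 \/ z = t * 6 + 4 \/ z = t * 6 + 5 :> int.
  by exists (z %/ 6)%Z; lia.
move=> [|[|[|[|[|]]]]] ->.
- by exists (t * (6 * t - 1) * (6 * t - 2)); ring.
- by exists ((6 * t + 1) * t * (6 * t - 1)); ring.
- by exists ((6 * t + 2) * (6 * t + 1) * t); ring.
- by exists ((2 * t + 1) * (3 * t + 1) * (6 * t + 1)); ring.
- by exists (2 * (3 * t + 2) * (2 * t + 1) * (3 * t + 1)); ring.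
by exists ((6 * t + 5) * (3 * t + 2) * (2 * t + 1)); ring.
Qed.

Lemma zbin2D x y : zbin2 (x + y) = zbin2 x + x * y + zbin2 y.
Proof.
by apply: (@mulIf int 2) => //; rewrite !mulrDl !zbin2E; ring.
Qed.

Lemma zbin3D x y :
  zbin3 (x + y) = zbin3 x + zbin2 x * y + x * zbin2 y + zbin3 y.
Proof.
apply: (@mulIf int 6) => //.
rewrite !mulrDl !zbin3E -[6]/(2 * 3 : int)%R.
rewrite (_ : zbin2 x * y * (2 * 3) = zbin2 x * 2 * (y * 3)); last by ring.
rewrite (_ : x * zbin2 y * (2 * 3) = zbin2 y * 2 * (x * 3)); last by ring.
by rewrite !zbin2E; ring.
Qed.

Lemma zbin2_0 : zbin2 0 = 0. Proof. by []. Qed.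
Lemma zbin3_0 : zbin3 0 = 0. Proof. by []. Qed.

Lemma zbin2N x : zbin2 (- x) = x * x - zbin2 x.
Proof.
have := zbin2D (- x) x; rewrite addNr zbin2_0 => E.
by apply: (addIr (- x * x + zbin2 x)); rewrite addrA -E; ring.
Qed.

Lemma zbin3N x : zbin3 (- x) = zbin2 x * x - (x * x - zbin2 x) * x - zbin3 x.
Proof.
have := zbin3D (- x) x; rewrite addNr zbin3_0 zbin2N -!addrA => E.
apply: (addIr ((x * x - zbin2 x) * x + (- x * zbin2 x + zbin3 x))).
by rewrite -E; ring.
Qed.

Lemma zbin2_nat (n : nat) : zbin2 n = 'C(n, 2).
Proof.
elim: n => // n IH; rewrite -addn1 PoszD zbin2D IH addn1 binS bin1 PoszD.
by rewrite mulr1 addr0 addrC.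
Qed.

End IntBinomials.

(* The semidirect product of <x> = Z and Z^4, where x acts as 1 + N and N      *)
(* shifts the coordinates i -> j -> r -> s -> 0.  The coordinate e is the      *)
(* exponent of x, and (1 + N)^e expands with binomial coefficients.            *)
Definition unipotent_ext := (int * int * int * int * int)%type.

HB.instance Definition _ := Choice.on unipotent_ext.

Section UnipotentExtension.
Import GRing.Theory.
Local Open Scope ring_scope.
Local Notation U := unipotent_ext.

Definition ue_mul (u v : U) : U :=
  let: (e, i, j, r, s) := u in let: (e', i', j', r', s') := v in
  (e + e', i + i', j + i * e' + j', r + j * e' + i * zbin2 e' + r',
   s + r * e' + j * zbin2 e' + i * zbin3 e' + s').

Definition ue_one : U := (0, 0, 0, 0, 0).

Definition ue_inv (u : U) : U :=
  let: (e, i, j, r, s) := u in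
  (- e, - i, - (j + i * - e), - (r + j * - e + i * zbin2 (- e)),
   - (s + r * - e + j * zbin2 (- e) + i * zbin3 (- e))).

Lemma ue_mulA : associative ue_mul.
Proof.
move=> [[[[e i] j] r] s] [[[[e1 i1] j1] r1] s1] [[[[e2 i2] j2] r2] s2].
by rewrite /ue_mul zbin2D zbin3D; congr (_, _, _, _, _); ring.
Qed.

Lemma ue_mul1 : left_id ue_one ue_mul.
Proof.
by move=> [[[[e i] j] r] s]; rewrite /ue_mul; congr (_, _, _, _, _); ring.
Qed.

Lemma ue_mulg1 : right_id ue_one ue_mul.
Proof.
move=> [[[[e i] j] r] s]; rewrite /ue_mul /ue_one !(zbin2_0, zbin3_0).
by congr (_, _, _, _, _); ring.
Qed.

Lemma ue_mulV : left_inverse ue_one ue_inv ue_mul.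
Proof.
move=> [[[[e i] j] r] s]; rewrite /ue_mul /ue_inv !(zbin2N, zbin3N).
by congr (_, _, _, _, _); ring.
Qed.

Lemma ue_mulgV : right_inverse ue_one ue_inv ue_mul.
Proof.
move=> [[[[e i] j] r] s]; rewrite /ue_mul /ue_inv !(zbin2N, zbin3N).
by congr (_, _, _, _, _); ring.
Qed.

HB.instance Definition _ :=
  isGroup.Build unipotent_ext ue_mulA ue_mul1 ue_mulg1 ue_mulV ue_mulgV.

Lemma ue_mulE (u v : U) : (u * v)%g = ue_mul u v. Proof. by []. Qed.

(** The last coordinate may stay unspecified: by [ue_commJE] a further commutator does not depend on
    it. *)
Lemma ue_commE e i j r s e' i' j' r' s' : exists s'' : int,
  [~ (e, i, j, r, s) : U, (e', i', j', r', s') : U]%g =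
  (0, 0, i * e' - i' * e, j * e' + i * zbin2 e' - (j' * e + i' * zbin2 e), s'').
Proof.
set h := (e, _, _, _, _) : U; set t := (e', _, _, _, _) : U.
exists ((h * t)%g.2 - (t * h)%g.2).
apply: (mulgI (t * h)%g); rewrite -commgC !ue_mulE /h /t /= !(zbin2_0, zbin3_0).
by congr (_, _, _, _, _); ring.
Qed.

Lemma ue_commJE J R S e' i' j' r' s' :
  [~ (0, 0, J, R, S) : U, (e', i', j', r', s') : U]%g =
  (0, 0, 0, J * e', R * e' + J * zbin2 e').
Proof.
set h := (0, _, _, _, _) : U; set t := (e', _, _, _, _) : U.
apply: (mulgI (t * h)%g); rewrite -commgC !ue_mulE /h /t /= !(zbin2_0, zbin3_0).
by congr (_, _, _, _, _); ring.
Qed.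

End UnipotentExtension.

Section IntegerPowers.
Import GRing.Theory.

Variable gT : finGroupType.
Implicit Types (x y : gT) (z t : int).
Local Notation N := #|[set: gT]|.

(** Integer powers, with the exponent reduced modulo the order of the ambient group, which every
    element's order divides. *)
Definition zexp x z : gT := x ^+ `|(z %% N)%Z|%N.

Lemma expg_cardT x : x ^+ N = 1.
Proof. by apply: expg_cardG; rewrite inE. Qed.

Lemma zexp_nat x (n : nat) : zexp x n = x ^+ n.
Proof. by rewrite /zexp modz_nat absz_nat expg_mod ?expg_cardT. Qed.

Lemma zexp_cong x z t : (z = t %[mod N])%Z -> zexp x z = zexp x t.
Proof. by rewrite /zexp => ->. Qed.

Lemma int_mod_nat z (M : nat) : 0 < M -> exists n : nat, (z = n %[mod M])%Z.
Proof.
move=> M_gt0; exists `|(z %% M)%Z|%N; rewrite gez0_abs ?modz_mod //.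
by rewrite modz_ge0 // eqz_nat -lt0n.
Qed.

Lemma zexp_rep z : exists n : nat, (z = n %[mod N])%Z.
Proof. exact/int_mod_nat/cardG_gt0. Qed.

Lemma zexpD x z t : zexp x (z + t)%R = zexp x z * zexp x t.
Proof.
have [[n zn] [k tk]] := (zexp_rep z, zexp_rep t).
rewrite (zexp_cong x zn) (zexp_cong x tk) !zexp_nat -expgD -zexp_nat.
by apply: zexp_cong; rewrite -modzDm zn tk modzDm PoszD.
Qed.

Lemma zexpM x z t : zexp x (z * t)%R = zexp (zexp x z) t.
Proof.
have [[n zn] [k tk]] := (zexp_rep z, zexp_rep t).
rewrite (zexp_cong x zn) (zexp_cong _ tk) !zexp_nat -expgM -zexp_nat.
by apply: zexp_cong; rewrite -modzMm zn tk modzMm PoszM.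
Qed.

Lemma zexpMn x y z : commute x y -> zexp (x * y) z = zexp x z * zexp y z.
Proof. by move=> cxy; rewrite /zexp expgMn. Qed.

Lemma zexp1n z : zexp 1 z = 1. Proof. by rewrite /zexp expg1n. Qed.
Lemma zexp0 x : zexp x 0 = 1. Proof. by rewrite (zexp_nat x 0). Qed.
Lemma zexp1 x : zexp x 1 = x. Proof. by rewrite (zexp_nat x 1). Qed.

Lemma commute_zexp x y z : commute x y -> commute x (zexp y z).
Proof. exact: commuteX. Qed.

End IntegerPowers.

(** * From the unipotent extension to H with H/Z_2(H) = G *)

Section Sufficiency.
Import GRing.Theory.

Variables (gT : finGroupType) (G : {group gT}) (a d : gT).
Local Notation c := [~ d, a].
Local Notation U := unipotent_ext.
Local Notation N := #|[set: gT]|.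
Hypotheses (defG : G :=: <[d]> <*> <[a]>).
Hypotheses (ccd : commute c d) (cca : commute c a).
Hypothesis a_split : forall e i j,
  a ^+ e * d ^+ i * c ^+ j = 1 -> a ^+ e = 1.
Hypothesis a_kernel : forall e,
  a ^+ e = 1 <-> d ^+ e * c ^+ 'C(e, 2) = 1.

Let L (r s : int) := zexp d r * zexp c s = 1.

Let cdc r s : commute (zexp d r) (zexp c s).
Proof. by apply/commute_zexp/commute_sym/commute_zexp. Qed.

Local Lemma latticeD r s r' s' : L r s -> L r' s' -> L (r + r')%R (s + s')%R.
Proof.
rewrite /L !zexpD => rs rs'.
by rewrite mulgA -(mulgA (zexp d r)) cdc mulgA rs mul1g.
Qed.

Local Lemma latticeZ r s t : L r s -> L (r * t)%R (s * t)%R.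
Proof. by rewrite /L !zexpM -zexpMn // => ->; rewrite zexp1n. Qed.

Local Lemma commXX (i e : int) : 
  zexp d i * zexp a e = zexp a e * zexp d i * zexp c (i * e)%R.
Proof.
have [[n ni] [m me]] := (zexp_rep gT i, zexp_rep gT e).
rewrite (zexp_cong d ni) (zexp_cong a me) !zexp_nat commgC; congr (_ * _).
rewrite commXXg ?[commute _ c]commute_sym //; try exact: commute_sym.
by rewrite -zexp_nat; apply: zexp_cong; rewrite -[RHS]modzMm ni me modzMm PoszM.
Qed.

(** Here d^r is a power of c, so it commutes with a, while [d^r,a] = c^r. This makes the lattice
    stable under x. *)
Local Lemma lattice_shift r s : L r s -> L 0%R r.
Proof.
rewrite /L zexp0 mul1g => rs.
have := commXX r 1; rewrite zexp1 mulr1.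
have cac : commute a (zexp c s) by apply/commute_zexp/commute_sym.
have -> : zexp d r = (zexp c s)^-1.
  by apply/esym/mulg1_eq; rewrite -cdc.
move=> eqc; apply: (mulgI (a * (zexp c s)^-1)); rewrite -eqc mulg1.
exact/esym/commuteV.
Qed.

Definition ue_cover (u : U) : gT :=
  let: (e, i, j, _, _) := u in zexp a e * zexp d i * zexp c j.

Lemma ue_coverM : {morph ue_cover : u v / u * v}.
Proof.
move=> [[[[e i] j] r] s] [[[[e' i'] j'] r'] s'].
rewrite ue_mulE /ue_cover /= !zexpD.
have ca k l : commute (zexp c k) (zexp a l).
  exact/commute_zexp/commute_sym/commute_zexp/commute_sym.
have c5 : commute (zexp c (i * e')%R) (zexp c j).
  by apply/commute_zexp/commute_sym/commute_zexp.
have := commXX i e'; move: (cdc i' j) (ca j e') (cdc i' (i * e')%R) c5.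
move: (zexp a e) (zexp a e') (zexp d i) (zexp d i') (zexp c j) (zexp c j')
  (zexp c (i * e')%R) => P P' Q Q' C1 C' Z c1 c2 c3 c5 c4.
rewrite -!mulgA; congr (_ * _).
have -> : Q * (C1 * (P' * (Q' * C'))) = Q * P' * Q' * C1 * C'.
  by rewrite (mulgA C1 P') c2 -(mulgA P' C1) (mulgA C1 Q') -c1 -(mulgA Q' C1) !mulgA.
rewrite c4 -!mulgA; congr (_ * (_ * _)).
by rewrite (mulgA Z Q') -c3 -(mulgA Q' Z) (mulgA Z C1) c5 -(mulgA C1 Z).
Qed.

Lemma ue_cover_in u : ue_cover u \in G.
Proof.
have [[Gd Ga] Gc] := mem_gen2 defG; case: u => [[[[e i] j] r] s].
by rewrite !groupM ?groupX.
Qed.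

Lemma ue_cover_surj g : g \in G -> exists u, ue_cover u = g.
Proof.
rewrite defG joingC -[_ <*> _]/(gval (<[a]> <*> <[d]>)%G) => Gg.
have ccd' : commute [~ a, d] d.
  by rewrite -invgR; apply/commute_sym/commuteV/commute_sym.
have cca' : commute [~ a, d] a.
  by rewrite -invgR; apply/commute_sym/commuteV/commute_sym.
have [i [j [l ->]]] := gen2_normal_form (erefl _) cca' ccd' Gg.
exists (Posz i, Posz j, (- Posz l)%R, 0%R, 0%R).
rewrite /ue_cover !zexp_nat; congr (_ * _).
apply: (mulIg (zexp c l)); rewrite -zexpD addNr zexp0 zexp_nat.
by rewrite -(invgR d a) expVgn mulVg.
Qed.

(** Extends [a_kernel] to integers. The reduction is modulo 2N because C(e,2) modulo N depends on e
    modulo 2N. *)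
Lemma zexp_kernel (e : int) : zexp a e = 1 <-> L e (zbin2 e).
Proof.
have [|n en] := @int_mod_nat e (2 * N); first by rewrite muln_gt0 cardG_gt0.
have [t et] : exists t : int, (e = n%:Z + 2 * N%:Z * t)%R.
  have : (Posz (2 * N) %| (e - n%:Z)%R)%Z by rewrite -eqz_mod_dvd en.
  by case/dvdzP=> t /eqP; rewrite subr_eq => /eqP ->; exists t; rewrite PoszM; ring.
have eN : (e = n %[mod N])%Z.
  apply/eqP; rewrite eqz_mod_dvd et; apply/dvdzP; exists (2 * t)%R; ring.
have bN : (zbin2 e = 'C(n, 2) %[mod N])%Z.
  apply/eqP; rewrite eqz_mod_dvd et zbin2D zbin2_nat; apply/dvdzP.
  exists (n%:Z * (2 * t) + t * (2 * N%:Z * t - 1))%R.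
  apply: (@mulIf int 2) => //.
  rewrite !(mulrDl, mulNr) zbin2E; ring.
by rewrite /L (zexp_cong a eN) (zexp_cong d eN) (zexp_cong _ bN) !zexp_nat.
Qed.

Lemma ue_cover_eq1 e i j r s :
  ue_cover (e, i, j, r, s) = 1 <-> zexp a e = 1 /\ L i j.
Proof.
rewrite /ue_cover /L; split=> [eq1 | [-> ij]]; last by rewrite mul1g.
have ae : zexp a e = 1 by apply: a_split eq1.
by split=> //; move: eq1; rewrite ae mul1g.
Qed.

Definition ue_relations_mem (u : U) : Prop :=
  let: (e, i, j, r, s) := u in [/\ e = 0, i = 0, j = 0 & L r s]%R.

Lemma ue_relationsM u v :
  ue_relations_mem u -> ue_relations_mem v -> ue_relations_mem (u * v).
Proof.
case: u v => [[[[e i] j] r] s] [[[[e' i'] j'] r'] s'].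
move=> [-> -> -> rs] [-> -> -> rs']; rewrite ue_mulE /= !(zbin2_0, zbin3_0).
split=> //; rewrite !(mul0r, mulr0, addr0); exact: latticeD.
Qed.

Lemma ue_relationsJ u v : ue_relations_mem u -> ue_relations_mem (u ^ v).
Proof.
case: u v => [[[[e i] j] r] s] [[[[e' i'] j'] r'] s'] [-> -> -> rs].
set h := (_, _, _, r, s) : U; set t := (e', _, _, _, _) : U.
have -> : h ^ t = (0, 0, 0, r, s + r * e')%R :> U.
  apply: (mulgI t); rewrite -conjgC !ue_mulE /h /t /= !(zbin2_0, zbin3_0).
  by congr (_, _, _, _, _); ring.
split=> //; have := latticeD rs (latticeZ e' (lattice_shift rs)).
by rewrite mul0r addr0.
Qed.

Lemma ue_relations1 : ue_relations_mem 1.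
Proof. by split=> //; rewrite /L !zexp0 mulg1. Qed.

Lemma ue_relationsV u : ue_relations_mem u -> ue_relations_mem u^-1.
Proof.
case: u => [[[[e i] j] r] s] [-> -> -> rs].
set h := (_, _, _, _, _) : U.
have -> : h^-1 = (0, 0, 0, - r, - s)%R :> U.
  apply: (mulgI h); rewrite mulgV ue_mulE /h /= !(zbin2_0, zbin3_0).
  by congr (_, _, _, _, _); ring.
by split=> //; have := latticeZ (-1) rs; rewrite !mulrN1.
Qed.

Definition ue_relations :=
  NormalSubgroup ue_relations1 ue_relationsM ue_relationsV
    (fun u v => @ue_relationsJ u v).

(** The vectors (r,s) of the [u,v,w] are integral combinations of (i,j), (e,C(e,2)) and their shifts
    (0,i), (0,e). Conversely v = w = x gives (i,j), and v the first basis vector of Z^4 with w = x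
    gives -(e,C(e,2)). *)
Lemma ue_cover_kernel u :
  ue_cover u = 1 <-> forall v w : U, ue_relations [~ [~ u, v], w].
Proof.
case: u => [[[[e i] j] r] s]; rewrite ue_cover_eq1 zexp_kernel.
split=> [[Le Li] [[[[e1 i1] j1] r1] s1] [[[[e2 i2] j2] r2] s2] | Nuv].
  have [S ->] := ue_commE e i j r s e1 i1 j1 r1 s1.
  rewrite ue_commJE; split=> //.
  set J := (i * e1 - i1 * e)%R.
  set R := (_ - _)%R.
  have Li0 := lattice_shift Li; have Le0 := lattice_shift Le.
  have LJ : L 0 J.
    have := latticeD (latticeZ e1 Li0) (latticeZ (- i1) Le0).
    by rewrite !mul0r addr0 mulrN (mulrC e).
  have LR : L J R.
    have := latticeD (latticeD (latticeZ e1 Li) (latticeZ (zbin2 e1) Li0))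
      (latticeD (latticeZ (- i1) Le) (latticeZ (- j1) Le0)).
    by rewrite !mul0r !addr0 /J /R; congr L; ring.
  have := latticeD (latticeZ e2 LR) (latticeZ (zbin2 e2) LJ).
  by rewrite mul0r addr0.
have z1 : zbin2 1 = 0%R by [].
split; last first.
  have := Nuv (1, 0, 0, 0, 0)%R (1, 0, 0, 0, 0)%R.
  have [S ->] := ue_commE e i j r s 1 0 0 0 0; rewrite ue_commJE => -[_ _ _].
  by congr L; rewrite ?z1; ring.
have := Nuv (0, 1, 0, 0, 0)%R (1, 0, 0, 0, 0)%R.
have [S ->] := ue_commE e i j r s 0 1 0 0 0; rewrite ue_commJE => -[_ _ _].
move/(latticeZ (-1)); rewrite zbin2_0.
by congr L; rewrite ?z1; ring.
Qed.

Lemma capable2_split : capable 2 (subg_of G).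
Proof.
exact: (capable2_of_cover ue_coverM ue_cover_in ue_cover_surj ue_cover_kernel).
Qed.

End Sufficiency.

(** * The construction applied to the families *)

Lemma bin2D x y : 'C(x + y, 2) = ('C(x, 2) + x * y + 'C(y, 2))%N.
Proof. by elim: x => // x IH; rewrite addSn !binS IH !bin1; lia. Qed.

Lemma bin2M n e : 'C(n * e, 2) = (e * 'C(n, 2) + n * (n * 'C(e, 2)))%N.
Proof. by elim: e => [|e IH]; rewrite ?muln0 // mulnS bin2D IH binS bin1; nia. Qed.

Lemma modn_addM_dvd q n x y : q %| n -> x + n * y = x %[mod q].
Proof. by case/dvdnP=> u ->; rewrite addnC mulnAC modnMDl. Qed.

Section SufficientRelations.

Variables (m n q k : nat) (gT : finGroupType) (G : {group gT}) (a b : gT).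
Hypotheses (n_gt0 : 0 < n) (n_dvd_m : n %| m) (q_dvd_n : q %| n).
Hypotheses (Gab : pres_gens m n q k G a b) (tab : tight m n q a b).
Local Notation c := [~ a, b].

Lemma tight_expa e : a ^+ e = 1 <-> m %| e.
Proof.
case: Gab => _ am _ _ _; case: tab => _ tab'.
split=> [ae | /dvdnP[t ->]]; last by rewrite mulnC expgM am expg1n.
by case: (tab' e 0); rewrite // ae mul1g group1.
Qed.

(** Take d = b, so that [d,a] = c^-1. Both sides of [a_kernel] force e = n t, where b^e = c^(k t)
    and C(n t,2) is t C(n,2) modulo q. *)
Lemma capable_tight :
    (forall e, e * k = e * 'C(n, 2) %[mod q] <-> m %/ n %| e) ->
  capable 2 (subg_of G).
Proof.
case: (Gab) (tab) => defG am bn cq [cca ccb] [oc tab'] num.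
have Rba : [~ b, a] = c^-1 by rewrite invgR.
apply: (@capable2_split _ G a b).
- by rewrite defG joingC.
- by rewrite Rba; apply/commute_sym/commuteV/commute_sym.
- by rewrite Rba; apply/commute_sym/commuteV/commute_sym.
- move=> e i j eq1; apply/tight_expa; case: (tab' e i) => //.
  move/(canRL (mulgK _)): eq1; rewrite mul1g => ->.
  by rewrite Rba groupV groupX // groupV cycle_id.
move=> e; rewrite tight_expa Rba expVgn.
have -> : b ^+ e * c ^- 'C(e, 2) = 1 <-> b ^+ e = c ^+ 'C(e, 2).
  by split=> [/divg1_eq // | ->]; rewrite mulgV.
split=> [m_e | eq_b].
  have /dvdnP[t e_eq] := dvdn_trans n_dvd_m m_e; subst e.
  have : m %/ n %| t by rewrite dvdn_divLR // .
  move/num => eqm; rewrite mulnC expgM bn -expgM bin2M mulnC.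
  by apply/eqP; rewrite eq_expg_mod_order oc eqm modn_addM_dvd.
have n_e : n %| e by case: (tab' 0 e); rewrite // mul1g eq_b mem_cycle.
have /dvdnP[t e_eq] := n_e; subst e.
have : m %/ n %| t.
  apply/num; apply/eqP; rewrite -oc -eq_expg_mod_order mulnC expgM -bn -expgM mulnC eq_b.
  by rewrite eq_expg_mod_order oc (mulnC t n) bin2M modn_addM_dvd.
by rewrite dvdn_divLR.
Qed.

(** With d = b a the power formula contributes c^C(e,2), which cancels [d,a]^C(e,2); the condition
    becomes b^e a^e = 1, that is, m divides e. *)
Lemma capable_tight_balanced : n = m -> k = q -> capable 2 (subg_of G).
Proof.
case: (Gab) (tab) => defG am bn cq [cca ccb] [oc tab'] eq_nm eq_kq.
have Rba : [~ b * a, a] = c^-1.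
  by rewrite commMgJ commgg mulg1 commute_conj ?invgR //;
    rewrite -invgR; apply/commute_sym/commuteV/commute_sym.
have bm : b ^+ m = 1 by rewrite -eq_nm bn eq_kq cq.
have baX i : (b * a) ^+ i = b ^+ i * a ^+ i * c ^+ 'C(i, 2).
  by apply: expMg_Rmul; apply: commute_sym.
apply: (@capable2_split _ G a (b * a)).
- by rewrite joingMr defG joingC.
- by rewrite Rba; apply/commute_sym/commuteV/commute_sym/commuteM.
- by rewrite Rba; apply/commute_sym/commuteV/commute_sym.
- move=> e i j; rewrite Rba baX (commgC (b ^+ i)) => eq1; apply/tight_expa.
  have cw : [~ b ^+ i, a ^+ i] \in <[c]>.
    have [[Ga Gb] _] := mem_gen2 defG.
    by rewrite -(der1_gen2 defG) // mem_commg ?groupX.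
  have ab : a ^+ (e + i) * b ^+ i \in <[c]>.
    rewrite -(groupMr _ cw) -(groupMr _ (mem_cycle c 'C(i, 2))).
    rewrite -(groupMr _ (groupX j (groupVr (cycle_id c)))) expgD.
    by rewrite !mulgA in eq1 *; rewrite eq1 group1.
  case: (tab' _ _ ab); rewrite eq_nm => m_ei m_i.
  by rewrite -(dvdn_addl e m_i).
move=> e; rewrite tight_expa Rba baX expVgn mulgK.
split=> [/dvdnP[t ->] | ba1].
  by rewrite mulnC !expgM am bm !expg1n mulg1.
case: (tab' e e) => //; suff -> : a ^+ e * b ^+ e = 1 by apply: group1.
by rewrite -(mulg1_eq ba1) mulVg.
Qed.

End SufficientRelations.

Lemma good_exponents_capable p (gT : finGroupType) (G : {group gT})
    al be ga si :
    prime p -> good_exponents (al, be, ga, si) ->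
    presents_exponents p (al, be, ga, si) G ->
    si + (al - be) = ga /\ (odd p \/ ~~ ((al == be.+1) && (be == ga)))
      \/ [/\ p = 2, al = be.+1, be = ga & si = ga] ->
  capable 2 (subg_of G).
Proof.
move=> p_pr good presG cond.
have [a [b [Gab tab]]] := presents_exponents_tight p_pr good presG.
have p_gt0 i : 0 < p ^ i by rewrite expn_gt0 prime_gt0.
have /and5P[ga_gt0 ga_be be_al _ _] := good.
have n_m : p ^ be %| p ^ al by apply: dvdn_exp2l.
have q_n : p ^ ga %| p ^ be by apply: dvdn_exp2l.
(* In this case m/n = 1 and k = q, but C(q,2) is not 0 modulo q, so d = b fails and d = b a is
   used. *)
have [bal|nbal] := boolP ((p == 2) && (al == be) && (be == ga)).
  move: bal => /andP[/andP[/eqP p2 /eqP eq_al] /eqP eq_be].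
  apply: (capable_tight_balanced Gab tab); first by rewrite eq_al.
  by case: cond => [[<- _]|[_ _ _ -> //]]; rewrite eq_al subnn addn0.
apply: (capable_tight (p_gt0 be) n_m q_n Gab tab) => e.
rewrite -expnB // ?prime_gt0 //.
have easy : si + (al - be) = ga -> p ^ ga %| 'C(p ^ be, 2) ->
    (e * p ^ si = e * 'C(p ^ be, 2) %[mod p ^ ga] <-> p ^ (al - be) %| e).
  move=> si_eq q_C; have /eqP -> : p ^ ga %| e * 'C(p ^ be, 2) by apply: dvdn_mull.
  rewrite -si_eq expnD mulnC -[_ %% _ = 0]/(_ = _).
  split=> [/eqP | de]; first by rewrite -/(dvdn _ _) dvdn_pmul2l.
  by apply/eqP; rewrite -/(dvdn _ _) dvdn_pmul2l.
have [p_odd | /(prime_oddPn p_pr) p2] := boolP (odd p).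
  case: cond => [[si_eq _] | [p2]]; last by rewrite p2 in p_odd.
  by apply: easy => //; apply: dvdn_bin2_prime => //; left.
have [lt_gb | le_bg] := ltnP ga be.
  case: cond => [[si_eq _] | [_ _ eq_be]]; last by rewrite eq_be ltnn in lt_gb.
  by apply: easy => //; apply: dvdn_bin2_prime => //; right.
have eq_be : be = ga by apply/eqP; rewrite eqn_leq le_bg.
subst p be; rewrite !eqxx /= andbT in nbal.
have [g ga_eq] : exists g, ga = g.+1 by case: (ga) ga_gt0 => // g _; exists g.
rewrite ga_eq bin2_pow2 -ga_eq.
have odd_pred : odd (2 ^ ga).-1.
  by rewrite ga_eq -subn1 oddB ?expn_gt0 // expnS oddM.
case: cond => [[si_eq [//|]] | [_ -> _ ->]].
  rewrite eqxx andbT => al_neq.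
  (* C(q,2) is 2^g times an odd number and si < g, so C(q,2) - 2^si still has 2-adic valuation
     si. *)
  have le_sg : si < g by move: si_eq nbal al_neq be_al ga_eq; clear; lia.
  have [u g_eq] : exists u, g = (si + u.+1)%N.
    by exists (g - si).-1; move: le_sg; clear; lia.
  have d_eq : al - ga = u.+2 by move: si_eq g_eq ga_eq; clear; lia.
  rewrite d_eq ga_eq; move: odd_pred; rewrite ga_eq; move: (2 ^ g.+1).-1 => o o_odd.
  have -> : (2 ^ g = 2 ^ si * 2 ^ u.+1)%N by rewrite g_eq expnD.
  have -> : (2 ^ g.+1 = 2 ^ si * 2 ^ u.+2)%N by rewrite g_eq -expnD !addnS.
  have o1 : 0 < 2 ^ u.+1 * o by rewrite muln_gt0 expn_gt0 (odd_gt0 o_odd).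
  have le_e : e * 2 ^ si <= e * (2 ^ si * 2 ^ u.+1 * o).
    by rewrite -!mulnA leq_mul2l leq_pmulr ?orbT.
  have diff : (e * (2 ^ si * 2 ^ u.+1 * o) - e * 2 ^ si =
      2 ^ si * (e * (2 ^ u.+1 * o - 1)))%N.
    rewrite mulnBr muln1 mulnBr; congr (_ - _)%N; last exact: mulnC.
    by rewrite -!mulnA mulnCA.
  have cop : coprime (2 ^ u.+2) (2 ^ u.+1 * o - 1).
    by rewrite coprimeXl // coprime2n oddB // oddM oddX.
  split=> [/esym/eqP | de]; last apply/esym/eqP.
    by rewrite eqn_mod_dvd // diff dvdn_pmul2l ?expn_gt0 // Gauss_dvdl.
  by rewrite eqn_mod_dvd // diff dvdn_pmul2l ?expn_gt0 // Gauss_dvdl.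
(* Here k = q vanishes modulo q and C(q,2) alone, an odd multiple of q/2, has additive order 2 =
   m/n. *)
rewrite subSnn expn1 modnMl; move: odd_pred; rewrite ga_eq.
move: (2 ^ g.+1).-1 => o o_odd.
have dvdE : (2 ^ g.+1 %| e * (2 ^ g * o)) = (2 %| e).
  rewrite mulnCA expnSr dvdn_pmul2l ?expn_gt0 // Gauss_dvdl //.
  by rewrite coprime2n.
by rewrite -dvdE; split=> [/esym/eqP | /eqP].
Qed.

Lemma odd_index_capable p i (gT : finGroupType) (G : {group gT}) :
    prime p -> odd p -> odd_admissible i -> iso_odd p i G ->
  capable 2 (subg_of G).
Proof.
move=> p_pr p_odd adm /iso_oddE; have := odd_good adm.
case: i adm => [al|al ga|al be ga si] adm good presG;
  apply: (good_exponents_capable p_pr good presG); left; split;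
  by [left | rewrite subnn addn0 | case: adm; lia].
Qed.

Lemma even_index_capable i (gT : finGroupType) (G : {group gT}) :
    even_admissible i -> iso_even i G -> capable 2 (subg_of G).
Proof.
move=> adm /iso_evenE; have := even_good adm.
case: i adm => [be|be|al ga|al be ga si] adm good presG;
  apply: (good_exponents_capable (p := 2) isT good presG).
- by left; rewrite subnn addn0; split=> //; right; clear; lia.
- by right.
- by left; rewrite subnn addn0; split=> //; right; clear; lia.
case: adm => -[? ?] ? ? ? [? ?]; left; split; first by lia.
by right; lia.
Qed.

Theorem corollaryC (p : nat) (gT : finGroupType) (G : {group gT})
    (p_prime : prime p) (pG : p.-group G)
    (G_2gen : exists a b : gT, G :=: <<[set a; b]>>)
    (G_class2 : nil_class G = 2) :
  (odd p ->
     capable 2 (subg_of G) <->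
     exists! i : odd_index, odd_admissible i /\ iso_odd p i G) /\
  (p = 2 ->
     capable 2 (subg_of G) <->
     exists! i : even_index, even_admissible i /\ iso_even i G).
Proof.
split=> [p_odd | p2].
  split=> [capG | [i [[adm isoG] _]]]; last exact: odd_index_capable isoG.
  have [i [adm isoG]] := capable_odd_index p_prime p_odd pG G_2gen G_class2 capG.
  exists i; split=> // j [admj isoj]; apply: odd_exponents_inj => //.
  apply: (exponents_unique p_prime (odd_good adm) (odd_good admj)).
    by apply/iso_oddE; exact: isoG.
  by apply/iso_oddE; exact: isoj.
subst p; split=> [capG | [i [[adm isoG] _]]]; last exact: even_index_capable isoG.
have [i [adm isoG]] := capable_even_index pG G_2gen G_class2 capG.
exists i; split=> // j [admj isoj]; apply: even_exponents_inj => //.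
apply: (exponents_unique p_prime (even_good adm) (even_good admj)).
  by apply/iso_evenE; exact: isoG.
by apply/iso_evenE; exact: isoj.
Qed.
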